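(* Algorithm E, the explicit procedure given in the context, solves the $\exists$NE problem for coordination games $\mathcal{G}(G,C,\beta)$ on unweighted directed acyclic graphs $G$ with out-degree at most one in $\mathcal{O}(|G|^{2.5})$ time.
   Context: Unweighted coordination games. Let $M$ be a finite set of colours, $m=|M|$, $G=(V,E)$ a finite directed graph without self loops on $n>1$ nodes, $e=|E|$, $C:V\to 2^M\setminus\{\emptyset\}$ a colour assignment, and $\beta:V\times M\to\mathbb{Z}$ a bonus function. In the game $\mathcal{G}(G,C,\beta)$ the players are the nodes, the strategy set of node $i$ is $C(i)$, and for a joint strategy $s$ (with $s(i)\in C(i)$ for all $i$) the payoff of $i$ is $p_i(s)=|\{j\in N_i : s(j)=s(i)\}|+\beta(i,s(i))$, where $N_i=\{j:(j\to i)\in E\}$ (all edge weights are $1$). A (pure) Nash equilibrium is a joint strategy $s$ such that for every $i$ and every $x\in C(i)$, $p_i(s)\ge p_i(x,s_{-i})$. A query is a function $q:Q\to M$ with $\emptyset\ne Q\subseteq V$ and $q(i)\in C(i)$ for all $i\in Q$. A joint strategy $s$ is consistent with $q$ if $s(i)=q(i)$ for all $i\in Q$. $\exists$NE problem: given the game and a query $q$, decide whether some Nash equilibrium of the game is consistent with $q$. Algorithm E. Input: a coordination game $\mathcal{G}((V,E),C,\beta)$ and a query $q:Q\to M$. Output: YES if there is a Nash equilibrium consistent with $q$, NO otherwise. (1) Topologically sort $V$ into a sequence $(i_1,\dots,i_n)$. (2) For $j:=1,\dots,n$ do steps (a)–(c): (a) $X(i_j):=\emptyset$; $Y:=\{X(k)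 : (k\to i_j)\in E\}$. (b) For each $c\in C(i_j)$: – set $S:=\{Z\in Y : c\in Z\}$, $C':=C(i_j)\setminus\{c\}$, $Y':=Y\setminus S$; – if there is $c'\in C'$ with $|S|+\beta(i_j,c)-\beta(i_j,c')<0$, continue with the next $c$; – while there is $c'\in C'$ with $|S|+\beta(i_j,c)-\beta(i_j,c')\ge|Y'|$: set $C':=C'\setminus\{c'\}$ and $Y':=Y'\setminus\{Z\in Y' : c'\in Z\}$; – construct the bipartite graph $G'$ whose two vertex classes are $Y'$ and the set of all pairs $(c',x)$ with $c'\in C'$ and $x\in\{1,\dots,|S|+\beta(i_j,c)-\beta(i_j,c')\}$, with an edge from $Z$ to $(c',x)$ iff $c'\in Z$; – if the maximum bipartite matching in $G'$ has size $|Y'|$, add $c$ to $X(i_j)$. (c) If $i_j\in Q$: if $q(i_j)\notin X(i_j)$ return NO, else set $X(i_j):=\{q(i_j)\}$. (3) Return YES. The size of the game graph is $|G|=\mathcal{O}(nm+e)$. Bonuses are given in binary; running time is measured in the number of arithmetic operations.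
   Formalization: As printed, Algorithm E can wrongly answer NO; it is proved correct when C(k) ⊆ C(i) for every edge k→i, and for all games once Y' is changed to {Z ∈ Y∖S : Z ⊆ C(i)}; the time bound is proved for both versions. *)

(* Defs.v *)
From mathcomp Require Import all_boot all_order all_algebra.

Set Implicit Arguments.
Unset Strict Implicit.
Unset Printing Implicit Defensive.

Import Order.TTheory GRing.Theory Num.Theory.
Local Open Scope ring_scope.

(* [edge k i] is the edge k -> i; all edges have weight 1. *)
Record game := Game {
  node : finType;
  colour : finType;
  edge : rel node;
  avail : node -> {set colour};
  bonus : node -> colour -> int;
  node_gt1 : (1 < #|node|)%N;
  edge_irr : irreflexive edge;
  avail_neq0 : forall i, avail i != set0
}.

(* Values of [wanted] outside [asked] are irrelevant. *)
Record query (G : game) := Query {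
  asked : {set node G};
  wanted : node G -> colour G;
  asked_neq0 : asked != set0;
  wanted_avail : forall i, i \in asked -> wanted i \in avail i
}.

Section Equilibria.
Variable G : game.
Implicit Types (s : {ffun node G -> colour G}) (i j : node G) (x : colour G).

Definition joint_strategy s := forall i, s i \in avail i.

Definition payoff s i : int :=
  #|[set j | edge j i & s j == s i]|%:Z + bonus i (s i).

Definition deviate s i x : {ffun node G -> colour G} :=
  [ffun j => if j == i then x else s j].

Definition nash s :=
  joint_strategy s /\
  forall i x, x \in avail i -> payoff (deviate s i x) i <= payoff s i.

Definition consistent s (q : query G) :=
  forall i, i \in asked q -> s i = wanted q i.

Definition acyclic :=
  forall i (p : seq (node G)), path (@edge G) i p -> p != [::] -> last i p != i.

Definition out_degree_le1 := forall i, (#|[set j | edge i j]| <= 1)%N.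

Definition game_size : nat :=
  (#|node G| * #|colour G| + #|[set a : node G * node G | edge a.1 a.2]|)%N.

Definition preds i : seq (node G) := [seq k <- enum (node G) | edge k i].
Definition succs i : seq (node G) := [seq k <- enum (node G) | edge i k].

End Equilibria.

Definition upd (T : eqType) A (f : T -> A) (x : T) (a : A) : T -> A :=
  fun y => if y == x then a else f y.

(* A matching is listed as its edges; [adj u v] also says that u and v are
   vertices of the bipartite graph. *)
Definition matching (L R : eqType) (adj : L -> R -> bool) (mu : seq (L * R)) :=
  [&& uniq (unzip1 mu), uniq (unzip2 mu) & all (fun e => adj e.1 e.2) mu].

Definition maximum_matching (L R : eqType) (adj : L -> R -> bool) mu :=
  matching adj mu /\ forall nu, matching adj nu -> (size nu <= size mu)%N.

(* Y collects one set X(k) for each predecessor k of i, with repetitions: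
   |S| and |Y'| count predecessors, so Y and the collections derived from it are
   sequences.

   A predecessor that can take a colour outside C(i) without harm to i puts no
   constraint on i.  The procedure with Y' := Y \ S does not account for this:
   on the graph k -> i with C(k) = {a}, C(i) = {b} and no bonuses it computes
   X(i) = set0, as {a} has no edge in G', and it answers NO to the query
   i |-> b, although (a, b) is an equilibrium.  So there are two variants:
   - [verbatim = true]: Y' := Y \ S;
   - [verbatim = false]: Y' := {Z in Y \ S : Z is included in C(i)}.
   They coincide when C(k) is included in C(i) for all edges k -> i. *)
Definition constraining (verbatim : bool) (M : finType) (A Z : {set M}) :=
  verbatim || (Z \subset A).

Section AlgorithmE.
Variables (verbatim : bool) (G : game) (q : query G).
Local Notation V := (node G).
Local Notation M := (colour G).

Definition topological (order : seq V) :=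
  perm_eq order (enum V) /\
  forall k i, edge k i -> (index k order < index i order)%N.

(* [prune slack D Y D' Y']: the while loop that removes colours d with
   slack d >= |Y|, and the sets that contain them, can lead from (D, Y) to
   (D', Y'). *)
Inductive prune (slack : M -> int) :
    {set M} -> seq {set M} -> {set M} -> seq {set M} -> Prop :=
| PruneStop (D : {set M}) (Y : seq {set M}) :
    (forall d, d \in D -> slack d < (size Y)%:Z) -> prune slack D Y D Y
| PruneStep (D : {set M}) (Y : seq {set M}) d D' Y' :
    d \in D -> (size Y)%:Z <= slack d ->
    prune slack (D :\ d) [seq Z : {set M} <- Y | d \notin Z] D' Y' ->
    prune slack D Y D' Y'.

(* The graph G': the left vertices are the positions in Y, the right vertices
   are the pairs (d, x) with d in D and 1 <= x <= slack d. *)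
Definition bip_adj (slack : M -> int) (D : {set M}) (Y : seq {set M})
    (z : nat) (v : M * nat) : bool :=
  [&& (z < size Y)%N, v.1 \in D, (0 < v.2)%N, v.2%:Z <= slack v.1
    & v.1 \in nth set0 Y z].

(* [tested i Y c b]: the set X(i) being computed for the node i receives c
   iff b.  In the names of the source, D is C' and Y0 is the initial Y'. *)
Definition tested (i : V) (Y : seq {set M}) (c : M) (b : bool) : Prop :=
  let S := [seq Z : {set M} <- Y | c \in Z] in
  let D := avail i :\ c in
  let Y0 := [seq Z : {set M} <- Y |
               (c \notin Z) && constraining verbatim (avail i) Z] in
  let slack d := (size S)%:Z + bonus i c - bonus i d in
  ((exists2 d, d \in D & slack d < 0) /\ b = false) \/
  ((forall d, d \in D -> 0 <= slack d) /\
   exists D' Y' mu,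
     [/\ prune slack D Y0 D' Y',
         maximum_matching (bip_adj slack D' Y') mu
       & b = (size mu == size Y')]).

(* [coloured i X Xi]: Xi is the set computed for X(i) from the table X, before
   the query is taken into account. *)
Definition coloured (i : V) (X : V -> {set M}) (Xi : {set M}) : Prop :=
  Xi \subset avail i /\
  forall c, c \in avail i -> tested i [seq X k | k <- preds i] c (c \in Xi).

(* [run order X b]: treating the nodes of [order] in turn, from the table X, can
   return b. *)
Inductive run : seq V -> (V -> {set M}) -> bool -> Prop :=
| RunEnd X : run [::] X true
| RunReject i order X Xi :
    coloured i X Xi -> i \in asked q -> wanted q i \notin Xi ->
    run (i :: order) X false
| RunAsked i order X Xi b :
    coloured i X Xi -> i \in asked q -> wanted q i \in Xi ->
    run order (upd X i [set wanted q i]) b -> run (i :: order) X b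
| RunFree i order X Xi b :
    coloured i X Xi -> i \notin asked q ->
    run order (upd X i Xi) b -> run (i :: order) X b.

(* Some run of the algorithm returns b (true for YES). *)
Definition algorithm_E (b : bool) : Prop :=
  exists2 order, topological order & run order (fun=> set0) b.

End AlgorithmE.

Record timed A := Timed { outcome : A; cost : nat }.

Definition ret A (a : A) : timed A := Timed a 0.

Definition bind A B (m : timed A) (f : A -> timed B) : timed B :=
  Timed (outcome (f (outcome m))) (cost m + cost (f (outcome m))).

Notation "'let!' x := m 'in' k" := (bind m (fun x => k))
  (at level 200, x strict pattern, m at level 100, k at level 200,
   format "'[v' 'let!'  x  :=  m  'in' '/' k ']'").

(* [op a] is one elementary operation with result a: an arithmetic operation or
   comparison, the reading or writing of one table entry, the extension of a
   list by one item.  Sets of colours are bit tables, passed by reference, so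
   that reading or setting one bit is one operation. *)
Definition op A (a : A) : timed A := Timed a 1.

(* [fill n a]: the creation of the table a, of n entries. *)
Definition fill (n : nat) A (a : A) : timed A := Timed a n.

Fixpoint foreach A S (s : seq A) (z : S) (body : S -> A -> timed S) : timed S :=
  if s is a :: s' then
    let! _ := op tt in
    let! z' := body z a in
    foreach s' z' body
  else op z.

Fixpoint tmap A B (f : A -> timed B) (s : seq A) : timed (seq B) :=
  if s is a :: s' then
    let! b := f a in
    let! r := tmap f s' in
    op (b :: r)
  else op [::].

Fixpoint tfilter A (p : A -> timed bool) (s : seq A) : timed (seq A) :=
  if s is a :: s' then
    let! b := p a in
    let! r := tfilter p s' in
    op (if b then a :: r else r)
  else op [::].

Definition tsize A (s : seq A) : timed nat := foreach s 0%N (fun n _ => op n.+1).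

Definition tsubset (M : finType) (Z A : {set M}) : timed bool :=
  foreach (enum M) true (fun b d => op (b && ((d \in Z) ==> (d \in A)))).

(* [timed_E] is a deterministic implementation of [algorithm_E]; the input is
   read from the lists [preds i], [succs i], [enum (avail i)], the list of the
   nodes, and tables for [avail], [bonus], [asked] and [wanted]. *)
Section TimedAlgorithmE.
Variables (verbatim : bool) (G : game) (q : query G).
Local Notation V := (node G).
Local Notation M := (colour G).

(* Topological sort: repeatedly output a node all of whose predecessors have
   been output; [todo] lists the candidates, [deg] counts the predecessors that
   have not been output.  [fuel] bounds the number of rounds. *)
Fixpoint kahn (fuel : nat) (deg : V -> nat) (todo : seq V) : timed (seq V) :=
  if fuel is fuel'.+1 then
    if todo is i :: todo' then
      let! (deg', todo'') := foreach (succs i) (deg, todo') (fun st k =>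
        let: (deg, todo) := st in
        let! d := op (deg k).-1 in
        let! deg' := op (upd deg k d) in
        let! z := op (d == 0)%N in
        if z then op (deg', k :: todo) else ret (deg', todo)) in
      let! order := kahn fuel' deg' todo'' in
      op (i :: order)
    else op [::]
  else op [::].

Definition timed_topsort : timed (seq V) :=
  let! deg0 := fill #|V| (fun _ : V => 0%N) in
  let! deg := foreach (enum V) deg0 (fun deg i =>
    let! d := tsize (preds i) in
    op (upd deg i d)) in
  let! todo := tfilter (fun i => op (deg i == 0)%N) (enum V) in
  kahn #|V| deg todo.

Fixpoint insert (i : V) (c : M) (s : seq M) : timed (seq M) :=
  if s is d :: s' then
    let! b := op (bonus i c <= bonus i d) in
    if b then op (c :: s)
    else
      let! r := insert i c s' in
      op (d :: r)
  else op [:: c].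

Definition timed_sort (i : V) (s : seq M) : timed (seq M) :=
  foreach s [::] (fun r c => insert i c r).

(* The list D is sorted by nondecreasing bonus, that is nonincreasing slack, so
   if some colour of D can be removed then the first one can. *)
Fixpoint timed_prune (slack : M -> timed int) (D : seq M) (Y : seq {set M}) :
    timed (seq M * seq {set M}) :=
  if D is d :: D' then
    let! v := slack d in
    let! y := tsize Y in
    let! b := op (y%:Z <= v) in
    if b then
      let! Y' := tfilter (fun Z : {set M} => op (d \notin Z)) Y in
      timed_prune slack D' Y'
    else ret (D, Y)
  else op ([::], Y).

(* Maximum matching in G' by augmenting paths.  A left vertex is a pair (z, Z),
   with z a position in Y and Z the set found there.  [classes] lists the right
   vertices: (d, t) stands for (d, 1), ..., (d, t).  These all have the same
   neighbours, the (z, Z) with d \in Z, so a search explores them together, and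
   at most once; [seen] is the set of the colours explored.  [mate d x] is the
   left vertex matched to (d, x). *)
Local Notation left_vertex := (nat * {set M})%type.
Local Notation mates := (M -> nat -> option left_vertex).

Definition set_mate (mate : mates) (d : M) (x : nat) (u : left_vertex) : mates :=
  upd mate d (upd (mate d) x (Some u)).

(* Depth-first search of an augmenting path from u; the boolean in the state
   tells whether one has been found.  Nested searches explore distinct colours,
   whence the bound [fuel] on their depth. *)
Fixpoint augment (fuel : nat) (classes : seq (M * nat)) (u : left_vertex)
    (st : bool * {set M} * mates) : timed (bool * {set M} * mates) :=
  if fuel is fuel'.+1 then
    foreach classes st (fun st cl =>
      let: (found, seen, mate) := st in
      let: (d, t) := cl in
      let! b := op [&& ~~ found, d \in u.2 & d \notin seen] in
      if b then
        let! seen' := op (d |: seen) in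
        foreach (iota 1 t) (false, seen', mate) (fun st x =>
          let: (found, seen, mate) := st in
          if found then op st
          else
            let! w := op (mate d x) in
            if w is Some u' then
              let! (found', seen', mate') :=
                augment fuel' classes u' (false, seen, mate) in
              if found' then op (true, seen', set_mate mate' d x u)
              else op (false, seen', mate')
            else op (true, seen, set_mate mate d x u))
      else op st)
  else op st.

Definition timed_matching_size (classes : seq (M * nat)) (Y : seq {set M}) :
    timed nat :=
  let! y := tsize Y in
  let! us := fill y (zip (iota 0 y) Y) in
  let! mate0 := fill (#|M| * y.+1) (fun (_ : M) (_ : nat) => None) in
  let! k := tsize classes in
  let! (n, _) := foreach us (0%N, mate0) (fun st u =>
    let: (n, mate) := st in
    let! seen := fill #|M| set0 in
    let! (found, _, mate') := augment k.+1 classes u (false, seen, mate) in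
    if found then op (n.+1, mate') else op (n, mate')) in
  ret n.

Definition timed_test (i : V) (C : seq M) (Y : seq {set M}) (c : M) :
    timed bool :=
  let! Sc := tfilter (fun Z : {set M} => op (c \in Z)) Y in
  let! s := tsize Sc in
  let slack d :=
    let! v := op (s%:Z + bonus i c) in
    op (v - bonus i d) in
  let! D := tfilter (fun d => op (d != c)) C in
  let! neg := foreach D false (fun b d =>
    let! v := slack d in
    op (b || (v < 0))) in
  if neg then op false
  else
    let! Y0 := tfilter (fun Z : {set M} =>
      let! b := op (c \in Z) in
      if b then ret false
      else if verbatim then ret true
      else tsubset Z (avail i)) Y in
    let! (D', Y') := timed_prune slack D Y0 in
    let! classes := tmap (fun d =>
      let! v := slack d in
      op (d, `|v|%N)) D' in
    let! n := timed_matching_size classes Y' in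
    let! y := tsize Y' in
    op (n == y).

Fixpoint timed_run (order : seq V) (X : V -> {set M}) : timed bool :=
  if order is i :: order' then
    let! C := timed_sort i (enum (avail i)) in
    let! Y := tmap (fun k => op (X k)) (preds i) in
    let! X0 := fill #|M| set0 in
    let! Xi := foreach C X0 (fun Xi c =>
      let! b := timed_test i C Y c in
      if b then op (c |: Xi) else ret Xi) in
    let! a := op (i \in asked q) in
    if a then
      let! b := op (wanted q i \in Xi) in
      if b then
        let! Xq := fill #|M| [set wanted q i] in
        let! X' := op (upd X i Xq) in
        timed_run order' X'
      else op false
    else
      let! X' := op (upd X i Xi) in
      timed_run order' X'
  else op true.

Definition timed_E : timed bool :=
  let! order := timed_topsort in
  let! X := fill (#|V| * #|M|) (fun _ : V => set0 : {set M}) in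
  timed_run order X.

End TimedAlgorithmE.

(* Main.v *)
Require Import Defs.
From mathcomp Require Import all_boot all_order all_algebra.
From mathcomp Require Import zify boolp.
From mathcomp Require Import reals exp.

Set Implicit Arguments.
Unset Strict Implicit.
Unset Printing Implicit Defensive.

Import Order.TTheory GRing.Theory Num.Theory.
Local Open Scope ring_scope.

(* Correctness.  In the order of the procedure, X(i) is the set of the colours c
   such that some choice of colours from the sets X(k) of the predecessors k of i
   makes c a best response.  In such a choice every predecessor that can play c
   may be assumed to play c, so that a colour d is affordable as long as it is
   played at most slack d times; colours with slack at least |Y'| are never
   exhausted, and the remaining condition is Hall's condition for G'.  Since every
   node has at most one successor, the choices explaining the sets X(i) can be
   combined, from the last node to the first, into an equilibrium.

   Running time.  If an augmenting search fails, then the slots of the explored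
   colours are all matched, to left vertices without other colours, which together
   with the root violate Hall's condition; so the number of successful searches is
   |Y'| iff a matching of that size exists.  A search explores each colour once
   and enters at most one call per matched slot; as slacks are less than |Y'|
   after pruning, it costs O(m |Y'|), hence O(m^2 delta^2) for a node with delta
   predecessors, and O((nm)^2) in total. *)

Local Notation tsize := Defs.tsize.

(** * Facts on lists *)

Lemma uniq_map_inj_in (T1 T2 : eqType) (f : T1 -> T2) (s : seq T1) :
  uniq (map f s) -> {in s &, injective f}.
Proof.
elim: s => //= x s IH /andP[fxs /IH inj] y z; rewrite !inE.
case/predU1P => [->|ys] /predU1P[->|zs] // fyz; last exact: inj.
- by rewrite fyz map_f in fxs.
- by rewrite -fyz map_f in fxs.
Qed.

Lemma iota_splitl z n : (z < n)%N -> iota 0 n = iota 0 z ++ z :: iota z.+1 (n - z.+1).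
Proof. by move=> lt; rewrite -{1}(subnKC (ltnW lt)) iotaD -{1}(subnSK lt). Qed.

(** * The test of a colour *)

Section Selections.
Variable M : finType.
Implicit Types (Y : seq {set M}) (P : seq (M * {set M})) (slack : M -> int).
Implicit Types (c d : M) (D Z : {set M}).

(* P lists the members of Y, each with the colour selected in it. *)
Definition selection Y P :=
  (unzip2 P == Y) && all (fun p : M * {set M} => p.1 \in p.2) P.

Definition load P d := count (fun p => p.1 == d) P.

(** This is the condition that G' has a matching of size |Y|, with the pairs (d, 1), ..., (d, slack
    d) merged into one colour d of capacity [slack d]. *)
Definition feasible slack D Y :=
  exists2 P, selection Y P & forall d, d \in D -> (load P d)%:Z <= slack d.

Lemma size_selection Y P : selection Y P -> size P = size Y.
Proof. by case/andP => /eqP <- _; rewrite size_map. Qed.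

Lemma selection_filter (a : pred {set M}) Y P :
  selection Y P -> selection (filter a Y) (filter (preim snd a) P).
Proof.
case/andP => /eqP <- sel; rewrite /selection filter_map eqxx /=.
by apply/allP => p; rewrite mem_filter => /andP[_ /(allP sel)].
Qed.

Lemma load_filter (a : pred (M * {set M})) P d :
  (load (filter a P) d <= load P d)%N.
Proof. by rewrite /load count_filter; apply: sub_count => p /andP[]. Qed.

(** The sets rejected by [a] receive their colour from [h]. This undoes both ways in which sets are
    dropped: pruning, with [h] constant, and the initial restriction of Y to the sets that constrain
    i. *)
Lemma selection_extend (a : pred {set M}) (h : {set M} -> M) Y P :
    selection (filter a Y) P ->
    (forall Z, Z \in Y -> ~~ a Z -> h Z \in Z) ->
  exists2 P', selection Y P' &
    forall d, load P' d = (load P d + count (fun Z => ~~ a Z && (h Z == d)) Y)%N.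
Proof.
elim: Y P => [|Z Y IH] P /=.
  by case: P => [|//] _ _; exists [::].
move=> selP hY.
have hY' Z' : Z' \in Y -> ~~ a Z' -> h Z' \in Z'.
  by move=> Z'Y; apply: hY; rewrite inE Z'Y orbT.
case: ifPn selP => [aZ|naZ] selP.
- case: P selP => [//|[d Z'] P]; rewrite /selection /= eqseq_cons.
  case/andP => /andP[/eqP -> eqP] /andP[dZ selP].
  have [|P' /andP[eqP' selP'] loadP'] := IH P _ hY'; first by rewrite /selection eqP.
  exists ((d, Z) :: P') => [|d'].
    by rewrite /selection /= eqseq_cons eqxx eqP' dZ.
  by rewrite /load /= -!/(load _ _) loadP' addnA.
- have [P' /andP[eqP' selP'] loadP'] := IH P selP hY'.
  exists ((h Z, Z) :: P') => [|d'].
    by rewrite /selection /= eqseq_cons eqxx eqP' selP' hY ?inE ?eqxx.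
  by rewrite /load /= -!/(load _ _) loadP' addnCA.
Qed.

End Selections.

(** * Pruning, and matchings as selections of bounded load *)

Section PruningAndMatching.
Variable G : game.
Local Notation M := (colour G).
Implicit Types (Y : seq {set M}) (P : seq (M * {set M})) (slack : M -> int).
Implicit Types (c d : M) (D Z : {set M}).

(** A removed colour d has capacity for all of Y, so every set containing d can take d and stops
    competing with the others. The sets that stay do not contain d, hence lie in the smaller D. *)
Lemma prune_feasible slack D Y D' Y' :
    prune slack D Y D' Y' -> all (fun Z : {set M} => Z \subset D) Y ->
  all (fun Z => Z \subset D') Y' /\ (feasible slack D Y <-> feasible slack D' Y').
Proof.
elim=> {D Y D' Y'} [D Y _ subD|D Y d D' Y' dD big _ IH subD]; first by split.
have sub' : all (fun Z : {set M} => Z \subset D :\ d)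
    [seq Z : {set M} <- Y | d \notin Z].
  apply/allP => Z; rewrite mem_filter => /andP[dZ ZY].
  by rewrite subsetD1 (allP subD).
have [subD' IHE] := IH sub'; split=> //; rewrite -IHE.
split=> - [P selP loadP].
  exists (filter (preim snd (fun Z : {set M} => d \notin Z)) P).
    exact: selection_filter.
  move=> d'; rewrite in_setD1 => /andP[_ /loadP]; apply: le_trans.
  by rewrite lez_nat load_filter.
(* All dropped sets take d; the load of d is at most |Y|, and [big] bounds |Y| by [slack d]. *)
have [|P' selP' loadP'] :=
    @selection_extend _ (fun Z : {set M} => d \notin Z) (fun=> d) Y P selP.
  by move=> Z _; rewrite negbK.
exists P' => // d' d'D; have [<-|nd] := eqVneq d d'.
  by apply: le_trans big; rewrite lez_nat -(size_selection selP') count_size.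
rewrite loadP' (@eq_count _ _ pred0); last by move=> Z /=; rewrite (negPf nd) andbF.
by rewrite count_pred0 addn0 loadP // in_setD1 eq_sym nd.
Qed.

Lemma size_matching slack D Y mu :
  matching (bip_adj slack D Y) mu -> (size mu <= size Y)%N.
Proof.
case/and3P => uniq1 _ /allP adj.
rewrite -(size_map fst) -(size_iota 0 (size Y)) uniq_leq_size // => z.
by case/mapP => e /adj /and5P[lt _ _ _ _] ->; rewrite mem_iota.
Qed.

(** Positions matched to the same colour d have distinct second components in 1, ..., slack d, which
    bounds the load of d. The colour [c] supplies a default for [nth]. *)
Lemma feasible_of_matching c slack D Y mu :
    (forall d, d \in D -> 0 <= slack d) ->
    matching (bip_adj slack D Y) mu -> size mu = size Y ->
  feasible slack D Y.
Proof.
move=> slack_ge0 /and3P[uniq1 uniq2 /allP adj] sz.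
pose e0 : nat * (M * nat) := (0%N, (c, 0%N)).
pose f z := (nth e0 mu (index z (unzip1 mu))).2.1.
have fE e : e \in mu -> f e.1 = e.2.1.
  move=> emu; rewrite /f -{1}(nth_index e0 emu) -(nth_map _ e0.1) ?index_mem //.
  by rewrite index_uniq ?size_map ?index_mem // nth_index.
have perm1 : perm_eq (unzip1 mu) (iota 0 (size Y)).
  apply: uniq_perm (iota_uniq _ _) _ => //.
  apply: (uniq_min_size uniq1 _ _).2.
    by move=> z /mapP[e /adj /and5P[lt _ _ _ _] ->]; rewrite mem_iota.
  by rewrite size_iota size_map sz.
exists [seq (f z, nth set0 Y z) | z <- iota 0 (size Y)].
  rewrite /selection; apply/andP; split.
    by apply/eqP; rewrite -[RHS](mkseq_nth set0) /unzip2 -map_comp.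
  rewrite all_map -(perm_all _ perm1) all_map.
  by apply/allP => e emu /=; rewrite fE //; case/and5P: (adj _ emu).
move=> d dD; rewrite /load count_map -(permP perm1) count_map.
rewrite (@eq_in_count _ _ (fun e => e.2.1 == d)); last by move=> e emu /=; rewrite fE.
rewrite -size_filter -(size_map (fun e => e.2.2)).
rewrite -(gez0_abs (slack_ge0 _ dD)) lez_nat -[leqRHS](size_iota 1).
apply: uniq_leq_size => [|x].
  rewrite map_inj_in_uniq ?filter_uniq ?(map_uniq uniq1) //.
  move=> [z [a x]] [z' [a' x']]; rewrite !mem_filter /=.
  move=> /andP[/eqP -> emu] /andP[/eqP -> emu'] xx'.
  by apply: (uniq_map_inj_in uniq2 emu emu'); rewrite /= xx'.
case/mapP => e; rewrite mem_filter => /andP[/eqP de /adj /and5P[_ _ x0 x1 _]] ->.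
by rewrite mem_iota x0 add1n ltnS -lez_nat gez0_abs -?de // slack_ge0 // de.
Qed.

(** Position z is matched to its selected colour [g z] with second component [r z], the rank of z
    among the positions up to z that select this colour. Ranks run from 1 to the load. *)
Lemma matching_of_feasible c slack D Y :
    all (fun Z : {set M} => Z \subset D) Y -> feasible slack D Y ->
  exists2 mu, matching (bip_adj slack D Y) mu & size mu = size Y.
Proof.
move=> /allP subD [P selP loadP]; have sz := size_selection selP.
case/andP: selP => /eqP unzipP /allP selP.
pose g z := (nth (c, set0) P z).1.
pose r z := (count (fun z' => g z' == g z) (iota 0 z)).+1.
have r_mono z z' : (z < z')%N -> g z = g z' -> (r z < r z')%N.
  move=> lt gz; rewrite /r -gz (iota_splitl lt) count_cat /= eqxx.
  by rewrite ltnS addnS ltnS leq_addr.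
have r_load z : (z < size Y)%N -> (r z <= load P (g z))%N.
  move=> lt; rewrite /r /load.
  have -> : count (fun p => p.1 == g z) P = count (fun z' => g z' == g z) (iota 0 (size Y)).
    by rewrite -sz -{1}[P](mkseq_nth (c, set0)) /mkseq count_map.
  by rewrite (iota_splitl lt) count_cat /= eqxx addnS ltnS leq_addr.
exists [seq (z, (g z, r z)) | z <- iota 0 (size Y)]; last by rewrite size_map size_iota.
apply/and3P; split.
- by rewrite /unzip1 -map_comp map_id_in ?iota_uniq.
- rewrite /unzip2 -map_comp map_inj_in_uniq ?iota_uniq // => z z' _ _ /= [gz rz].
  case: (ltngtP z z') => // lt.
    by have := r_mono _ _ lt gz; rewrite /r rz ltnn.
  by have := r_mono _ _ lt (esym gz); rewrite /r rz ltnn.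
- apply/allP => _ /mapP[z zY ->]; rewrite mem_iota /= add0n in zY.
  have zP : nth (c, set0) P z \in P by rewrite mem_nth ?sz.
  have ZY : (nth (c, set0) P z).2 = nth set0 Y z by rewrite -unzipP (nth_map (c, set0)) ?sz.
  have gD : g z \in D.
    by apply: (subsetP (subD _ (mem_nth set0 zY))); rewrite -ZY selP.
  rewrite /bip_adj /= gD zY -ZY selP // andbT /=.
  by apply: le_trans (loadP _ gD); rewrite lez_nat r_load.
Qed.

Lemma maximum_matching_feasible c slack D Y mu :
    (forall d, d \in D -> 0 <= slack d) -> all (fun Z : {set M} => Z \subset D) Y ->
    maximum_matching (bip_adj slack D Y) mu ->
  (size mu == size Y) <-> feasible slack D Y.
Proof.
move=> slack_ge0 subD [mat_mu max_mu]; split=> [/eqP sz|feas].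
  exact: feasible_of_matching mat_mu sz.
have [nu mat_nu sz_nu] := matching_of_feasible c subD feas.
by rewrite eqn_leq (size_matching mat_mu) -sz_nu max_mu.
Qed.
End PruningAndMatching.

(** * From tests to best responses *)

Section Testing.
Variable G : game.
Local Notation V := (node G).
Local Notation M := (colour G).
Implicit Types (i j k : V) (c d x : M) (Y : seq {set M}) (P : seq (M * {set M})).

(** Selecting c wherever possible is optimal: it raises the load of c to its maximum |S| and adds no
    load to other colours. What remains is feasibility for the constraining sets without c, which
    pruning preserves and the matching decides. *)
Lemma tested_selection (verbatim : bool) i Y c b :
    (verbatim -> all (fun Z : {set M} => Z \subset avail i) Y) -> tested verbatim i Y c b ->
  b <-> exists2 P, selection Y P & forall x, x \in avail i ->
          (load P x)%:Z + bonus i x <= (load P c)%:Z + bonus i c.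
Proof.
move=> subY.
set S := [seq Z : {set M} <- Y | c \in Z]; set D := avail i :\ c.
pose slack d := (size S)%:Z + bonus i c - bonus i d.
pose a := fun Z : {set M} => (c \notin Z) && (Z \subset avail i).
(* By [subY], in the verbatim variant every set lies in [avail i], so both variants start from
   [filter a Y]. *)
have -> : tested verbatim i Y c b <->
    ((exists2 d, d \in D & slack d < 0) /\ b = false) \/
    ((forall d, d \in D -> 0 <= slack d) /\ exists D' Y' mu,
      [/\ prune slack D (filter a Y) D' Y',
          maximum_matching (bip_adj slack D' Y') mu & b = (size mu == size Y')]).
  have E : [seq Z : {set M} <- Y | (c \notin Z) && constraining verbatim (avail i) Z]
      = filter a Y.
    apply: eq_in_filter => Z ZY; rewrite /a /constraining.
    by case: (verbatim) subY => [/(_ isT)/allP/(_ _ ZY) ->|].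
  by rewrite /tested E.
have R_iff : (exists2 P, selection Y P & forall x, x \in avail i ->
          (load P x)%:Z + bonus i x <= (load P c)%:Z + bonus i c) <->
    (forall d, d \in D -> 0 <= slack d) /\ feasible slack D (filter a Y).
  split=> [[P selP best]|[slack_ge0 [P selP loadP]]].
    have load_slack d : d \in D -> (load P d)%:Z <= slack d.
      rewrite in_setD1 => /andP[_ /best le]; rewrite /slack.
      (* A set from which c is selected contains c, hence counts in [S]. *)
      have : (load P c <= size S)%N.
        case/andP: selP => /eqP unzipP /allP selP.
        rewrite /S size_filter -unzipP count_map /load.
        rewrite (@eq_in_count _ _ (fun p : M * {set M} => (p.1 == c) && (c \in p.2))).
          by apply: sub_count => p /andP[].
        by move=> p /selP; case: eqP => [->|].
      by lia.
    split=> [d dD|]; first exact: le_trans (load_slack _ dD).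
    exists (filter (preim snd a) P) => [|d dD]; first exact: selection_filter.
    by apply: le_trans (load_slack _ dD); rewrite lez_nat load_filter.
  (* A predecessor that cannot play c and is free to leave C(i) does so. *)
  pose h (Z : {set M}) := if c \in Z then c else odflt c [pick x in Z :\: avail i].
  have [|P' selP' loadP'] := selection_extend (h := h) selP.
    move=> Z ZY; rewrite /h /a; case: ifP => //= _ /subsetPn[x xZ xi].
    by case: pickP => [y /setDP[]|/(_ x)] //; rewrite inE xZ xi.
  exists P' => // x xi; have [->//|xc] := eqVneq x c.
  have xD : x \in D by rewrite in_setD1 xc.
  have := loadP x xD; rewrite /slack.
  (* On the added sets [h] yields c or a colour outside [avail i], so the load of x does not
     grow. *)
  have -> : load P x = load P' x.
    rewrite loadP' (@eq_count _ _ pred0) ?count_pred0 ?addn0 // => Z /=.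
    apply/negP => /andP[aZ /eqP hx]; move: hx aZ; rewrite /h /a.
    case: ifP => [_ cx|/= cZ]; first by rewrite cx eqxx in xc.
    case: pickP => [y /setDP[_ yi] /= yx|_ /= cx]; first by rewrite yx xi in yi.
    by rewrite cx eqxx in xc.
  have : (size S <= load P' c)%N.
    rewrite loadP' size_filter -[leqLHS]add0n leq_add //.
    by apply: sub_count => Z cZ; rewrite /a /h cZ /= eqxx.
  by lia.
rewrite R_iff => -[[[d dD lt0] ->]|[slack_ge0 [D' [Y' [mu [pr max_mu ->]]]]]].
  by split=> // -[/(_ d dD)]; rewrite leNgt lt0.
have suba : all (fun Z : {set M} => Z \subset D) (filter a Y).
  by apply/allP => Z; rewrite mem_filter subsetD1 => /andP[/andP[-> ->]].
have [subD' ->] := prune_feasible pr suba.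
have subset_prune : forall slack D Y D' Y', @prune G slack D Y D' Y' -> D' \subset D.
  move=> ? ? ? ? ?; elim=> // D1 Y1 d D2 Y2 _ _ _ sub.
  exact: subset_trans sub (subD1set _ _).
have slack_ge0' d : d \in D' -> 0 <= slack d.
  by move=> /(subsetP (subset_prune _ _ _ _ _ pr)); apply: slack_ge0.
have := maximum_matching_feasible c slack_ge0' subD' max_mu.
by case=> m1 m2; split=> [/m1 ?|[_ /m2]].
Qed.

Definition supporters (s : V -> M) i x := #|[set j | edge j i & s j == x]|.

(** Only the strategies of the predecessors of i enter, so c can be judged before i has a
    strategy. *)
Definition best_response i (s : V -> M) c :=
  c \in avail i /\ forall x, x \in avail i ->
    (supporters s i x)%:Z + bonus i x <= (supporters s i c)%:Z + bonus i c.

(** As there are no self loops, a deviation of i leaves the supporters of each colour unchanged. *)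
Lemma nash_best_response (s : {ffun V -> M}) :
  nash s <-> forall i, best_response i s (s i).
Proof.
have pay i x : payoff (deviate s i x) i = (supporters s i x)%:Z + bonus i x.
  rewrite /payoff /supporters !ffunE eqxx; congr (Posz #|pred_of_set _| + _).
  apply/setP => j; rewrite !inE ffunE.
  by have [->|//] := eqVneq j i; rewrite edge_irr.
split=> [[joint best] i|best].
  by split=> // x xi; rewrite -pay best.
by split=> [i|i x xi]; [case: (best i)|rewrite pay; apply: (best i).2].
Qed.

Lemma supporters_count (s : V -> M) i x :
  supporters s i x = count (fun k => s k == x) (preds i).
Proof.
rewrite /supporters cardE {1}/enum_mem -enumT size_filter /preds count_filter.
by apply: eq_count => j /=; rewrite inE andbC.
Qed.

Lemma eq_supporters i (s s' : V -> M) x :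
  (forall k, edge k i -> s k = s' k) -> supporters s i x = supporters s' i x.
Proof.
move=> ss'; apply: eq_card => k; rewrite !inE.
by case: (edge k i) (ss' k) => // ->.
Qed.

Lemma mem_preds i k : (k \in preds i) = edge k i.
Proof. by rewrite mem_filter mem_enum andbT. Qed.

(** Positions in [preds i] turn a selection from the list of the sets [X k] into a choice function
    on the predecessors and back; loads become numbers of supporters. *)
Lemma colouredP (verbatim : bool) i (X : V -> {set M}) Xi c :
    (verbatim -> forall k, edge k i -> X k \subset avail i) ->
    coloured verbatim i X Xi ->
  c \in Xi <-> exists2 s : V -> M, (forall k, edge k i -> s k \in X k) & best_response i s c.
Proof.
move=> subX [subXi tst].
have [ci|nci] := boolP (c \in avail i); last first.
  by split=> [/(subsetP subXi)|[s _ []]]; rewrite (negPf nci).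
have subY : verbatim -> all (fun Z : {set M} => Z \subset avail i) [seq X k | k <- preds i].
  move=> /subX sub; rewrite all_map; apply/allP => k.
  by rewrite mem_preds /= => /sub.
rewrite (tested_selection subY (tst c ci)); split=> [[P]|[s sX [_ best]]].
  case/andP => /eqP unzipP selP best.
  pose s k := nth c (unzip1 P) (index k (preds i)).
  have szP : size P = size (preds i) by have := congr1 size unzipP; rewrite !size_map.
  have uniqp : uniq (preds i) by rewrite filter_uniq ?enum_uniq.
  have sE : [seq s k | k <- preds i] = unzip1 P.
    apply: (@eq_from_nth _ c); rewrite ?size_map // => n lt.
    by rewrite (nth_map i) // /s index_uniq.
  have loadE x : load P x = supporters s i x.
    rewrite supporters_count /load -(count_map s (pred1 x)) sE count_map.
    by apply: eq_count.
  exists s => [k|]; last by split=> // x; rewrite -!loadE; apply: best.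
  rewrite -mem_preds => kp.
  have lt : (index k (preds i) < size P)%N by rewrite szP index_mem.
  have := allP selP _ (mem_nth (c, set0) lt).
  rewrite /s (nth_map (c, set0)) //.
  rewrite -(nth_map _ set0 (@snd M {set M})) // [map _ P]unzipP.
  by rewrite (nth_map k) ?index_mem // nth_index.
exists [seq (s k, X k) | k <- preds i].
  rewrite /selection /unzip2 -map_comp eqxx all_map; apply/allP => k.
  by rewrite mem_preds; apply: sX.
have loadE x : load [seq (s k, X k) | k <- preds i] x = supporters s i x.
  by rewrite supporters_count /load count_map.
by move=> x xi; rewrite !loadE best.
Qed.
End Testing.

(** * Runs of the procedure *)

Section Runs.
Variables (G : game) (q : query G).
Local Notation V := (node G).
Local Notation M := (colour G).
Implicit Types (i j k : V) (c d x : M) (order : seq V) (X : V -> {set M}).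

(** A topological order in a form suited to induction along a run: [done] holds the nodes already
    treated, and the last clause makes the order exhaust all nodes. *)
Fixpoint topo_from (done : {set V}) order :=
  if order is i :: order' then
    [&& i \notin done, [forall k, edge k i ==> (k \in done)]
      & topo_from (i |: done) order']
  else done == setT.

Lemma topo_from_cat (l r : seq V) :
    (forall k i, edge k i -> (index k (l ++ r) < index i (l ++ r))%N) ->
    uniq (l ++ r) -> l ++ r =i V ->
  topo_from [set x in l] r.
Proof.
elim: r l => [|i r IH] l edges uniq_lr mem_lr /=.
  by apply/eqP/setP => k; rewrite !inE; have := mem_lr k; rewrite cats0.
have il : i \notin l.
  by move: uniq_lr; rewrite cat_uniq /= => /and3P[_ /norP[]].
rewrite inE il /=; apply/andP; split.
  apply/forallP => k; apply/implyP => /edges.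
  rewrite inE !index_cat (negPf il) /= eqxx addn0.
  by case: ifP => // _; lia.
have -> : i |: [set x in l] = [set x in rcons l i].
  by apply/setP => k; rewrite !inE mem_rcons inE.
by apply: IH; rewrite cat_rcons.
Qed.

Lemma topological_from order : topological order -> topo_from set0 order.
Proof.
case=> /[dup] /perm_mem mem_order /perm_uniq; rewrite enum_uniq => uniq_order edges.
have -> : set0 = [set x : V in [::]] by apply/setP => k; rewrite !inE.
apply: topo_from_cat => // k.
by rewrite cat0s mem_order mem_enum.
Qed.

Lemma topo_fromP done order : topo_from done order ->
  [/\ uniq order, forall k, (k \in order) = (k \notin done)
    & forall k i, edge k i -> i \in order ->
        (k \in done) || (index k order < index i order)%N].
Proof.
elim: order done => [|i order IH] done /=.
  by move/eqP => ->; split=> // k; rewrite !inE.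
case/and3P => nid /forallP preds_done /IH[uniq_order mem_order edges]; split.
- by rewrite mem_order !inE eqxx uniq_order.
- move=> k; rewrite inE mem_order !inE.
  by have [->|_] := eqVneq k i.
- move=> k j kj; rewrite inE ![i == _]eq_sym.
  have [eji|ji] /= := eqVneq j i.
    by rewrite eji in kj; have /implyP/(_ kj) -> := preds_done k.
  move=> jo; have := edges k j kj jo; rewrite !inE.
  case: eqP => //= _; rewrite ?orbT //.
Qed.

Lemma topological_of_from order : topo_from set0 order -> topological order.
Proof.
case/topo_fromP => uniq_order mem_order edges.
have all_order k : k \in order by rewrite mem_order inE.
split=> [|k i ki].
  by apply: uniq_perm; rewrite ?enum_uniq // => k; rewrite all_order mem_enum.
by have := edges k i ki (all_order i); rewrite inE.
Qed.

Definition explained X i :=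
  forall c, c \in X i ->
    exists2 s : V -> M, (forall k, edge k i -> s k \in X k) & best_response i s c.

(* Every node has at most one successor, so the strategies of the predecessors
   of a node can be changed without affecting the nodes treated later. *)
Lemma explained_equilibrium X : out_degree_le1 G ->
    forall done order, topo_from done order ->
    (forall i, X i != set0) -> (forall i, explained X i) ->
  exists2 s : V -> M, (forall i, s i \in X i)
    & forall i, i \in order -> best_response i s (s i).
Proof.
move=> deg1 done order topo X_neq0 expl; elim: order done topo => [|i order IH] done /=.
  (* Any choice from the nonempty sets will do; [wanted q i] serves as a default colour. *)
  move=> _; pose s i := odflt (wanted q i) [pick x in X i].
  exists s => // i; rewrite /s; case: pickP => // X0.
  by case/set0Pn: (X_neq0 i) => x; rewrite X0.
case/and3P => nid preds_done topo; have [s sX best] := IH _ topo.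
have [_ mem_order edges] := topo_fromP topo.
have [f fX best_f] := expl i _ (sX i).
(* The predecessors of i switch to the choice [f] that explains [s i]. Having i as their only
   successor, they precede no later node, and neither i nor a later node is one of them. *)
pose s' k := if edge k i then f k else s k.
have unique_succ k j : edge k i -> edge k j -> i = j.
  move=> ki kj; apply/eqP; have := deg1 k; apply: contraTT => ij.
  rewrite -ltnNge (cardD1 i) (cardD1 j) !inE ki kj eq_sym ij //.
exists s' => [k|j]; first by rewrite /s'; case: ifP => [/fX|_].
have s'E l : l = i \/ l \in order -> s' l = s l.
  rewrite /s' => -[->|lo]; first by rewrite edge_irr.
  case: ifP => // li; have := forallP preds_done l; rewrite li /=.
  by move: lo; rewrite mem_order !inE negb_or => /andP[_ /negPf ->].
rewrite inE => /predU1P[->|jo].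
  rewrite s'E; last by left.
  case: best_f => si best_f; split=> // x xi.
  have s'f k : edge k i -> s' k = f k by rewrite /s' => ->.
  by rewrite !(eq_supporters _ s'f); apply: best_f.
rewrite s'E; last by right.
case: (best j jo) => sj best_j; split=> // x xj.
have s's k : edge k j -> s' k = s k.
  move=> kj; rewrite /s'; case: ifP => // ki.
  by have ij := unique_succ _ _ ki kj; rewrite -ij mem_order !inE eqxx in jo.
by rewrite !(eq_supporters _ s's); apply: best_j.
Qed.

(** The first clause provides the equilibrium after YES, the last one excludes it after NO. Closure
    under predecessors ensures that the sets explaining a treated node are not overwritten later. *)
Definition run_invariant (done : {set V}) X :=
  [/\ forall i, i \in done -> [/\ X i \subset avail i, X i != set0, explained X i
        & i \in asked q -> X i = [set wanted q i]],
      forall i k, i \in done -> edge k i -> k \in done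
    & forall s, nash s -> consistent s q -> forall i, i \in done -> s i \in X i].

Lemma run_invariant_upd (verbatim : bool) done X i Xi Xi' :
    (verbatim -> forall k i : V, edge k i -> avail k \subset avail i) ->
    run_invariant done X -> i \notin done -> (forall k, edge k i -> k \in done) ->
    coloured verbatim i X Xi ->
    (i \in asked q -> Xi' = [set wanted q i] /\ wanted q i \in Xi) ->
    (i \notin asked q -> Xi' = Xi) ->
  run_invariant (i |: done) (upd X i Xi').
Proof.
move=> sub [inv closed nashX] nid preds_done col askd nasked.
have subX : verbatim -> forall k, edge k i -> X k \subset avail i.
  move=> /sub {}sub k ki; have [subk _ _ _] := inv k (preds_done k ki).
  exact: subset_trans subk (sub _ _ ki).
have sXi : Xi' \subset Xi.
  have [/askd[-> ]|/nasked ->//] := boolP (i \in asked q).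
  by rewrite sub1set.
have updE k : k \in done -> upd X i Xi' k = X k.
  by rewrite /upd; case: eqP => // -> /(negP nid).
have updi : upd X i Xi' i = Xi' by rewrite /upd eqxx.
(* Fix any choice from the nonempty sets of the predecessors: a colour that maximises the resulting
   payoff of i is a best response, hence lies in [Xi]. *)
have Xi_neq0 : Xi != set0.
  pose f k := odflt (wanted q k) [pick x in X k].
  have fX k : edge k i -> f k \in X k.
    move=> /preds_done /inv[_ /set0Pn[x xX] _ _]; rewrite /f.
    by case: pickP => [//|/(_ x)]; rewrite xX.
  have [c0 c0i] := set0Pn _ (avail_neq0 i).
  pose F x : int := (supporters f i x)%:Z + bonus i x.
  have [c ci best] := @arg_maxP _ _ _ c0 (mem (avail i)) F c0i.
  apply/set0Pn; exists c; rewrite (colouredP _ subX col).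
  by exists f => //; split=> // x; apply: best.
split.
- move=> k; rewrite !inE; have [-> _|ki /= kd] := eqVneq k i.
    rewrite updi; split.
    + by apply: subset_trans sXi col.1.
    + have [/askd[-> _]|/nasked ->//] := boolP (i \in asked q).
      by apply/set0Pn; exists (wanted q i); rewrite inE.
    + move=> c; rewrite updi => /(subsetP sXi); rewrite (colouredP _ subX col).
      by case=> s sX best; exists s => // k' k'i; rewrite updE ?sX ?preds_done.
    + by case/askd.
  have [sX X0 expl ask] := inv k kd; rewrite updE //; split=> // c.
  rewrite updE // => /expl[s sX' best]; exists s => // l lk.
  by rewrite updE ?sX' //; apply: closed lk.
- move=> j k; rewrite !inE => /predU1P[->/preds_done ->|jd kj]; first by rewrite orbT.
  by rewrite (closed j k jd kj) orbT.
- move=> s ns cs j; rewrite !inE => /predU1P[->|jd]; last by rewrite updE ?nashX.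
  rewrite updi; have [ia|/nasked ->] := boolP (i \in asked q).
    by have [-> _] := askd ia; rewrite cs ?inE.
  rewrite (colouredP _ subX col); exists s; last exact: (nash_best_response s).1.
  by move=> k /preds_done; apply: nashX.
Qed.

(** [order0] keeps the whole order: when a run ends, the list left to treat is empty, but the
    equilibrium is assembled backwards over all nodes. At a rejection, a consistent equilibrium
    would itself witness that the wanted colour lies in [Xi]. *)
Lemma run_correct (verbatim : bool) order0 done order X b : out_degree_le1 G ->
    (verbatim -> forall k i : V, edge k i -> avail k \subset avail i) ->
    topo_from set0 order0 ->
    run verbatim q order X b -> topo_from done order -> run_invariant done X ->
  b <-> exists s, nash s /\ consistent s q.
Proof.
move=> deg1 sub topo0 rn; elim: rn done => {order X b}
  [X|i order X Xi col ia nw|i order X Xi b col ia w _ IH|i order X Xi b col nia _ IH] done /=.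
- move=> /eqP done_all [inv _ _]; split=> // _.
  have {}inv i := inv i (eq_ind_r (fun A : {set V} => is_true (i \in A)) (in_setT i) done_all).
  have [||s sX best] := explained_equilibrium (X := X) deg1 topo0.
    1,2: by move=> i; case: (inv i).
  have all_order i : i \in order0.
    by case: (topo_fromP topo0) => _ -> _; rewrite inE.
  exists (finfun s); split=> [|i ia]; last first.
    by rewrite ffunE; case: (inv i) (sX i) => _ _ _ /(_ ia) -> /set1P.
  apply/nash_best_response => i; rewrite ffunE; case: (best i (all_order i)) => si best_i.
  split=> // x xi; rewrite !(eq_supporters (s' := s)); first exact: best_i.
    1,2: by move=> k _; rewrite ffunE.
- case/and3P => nid /forallP preds_done topo [inv closed nashX]; split=> // -[s [ns cs]].
  case/negP: nw; rewrite (colouredP _ _ col).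
    exists s; last by rewrite -cs //; apply: (nash_best_response s).1.
    by move=> k ki; apply: nashX => //; apply: (implyP (preds_done k)).
  move=> /sub {}sub k ki; have [subk _ _ _] := inv k (implyP (preds_done k) ki).
  exact: subset_trans subk (sub _ _ ki).
- case/and3P => nid /forallP preds_done topo inv; apply: IH topo _.
  apply: run_invariant_upd sub inv nid _ col _ _ => // [k|]; first exact/implyP.
  by rewrite ia.
- case/and3P => nid /forallP preds_done topo inv; apply: IH topo _.
  apply: run_invariant_upd sub inv nid _ col _ _ => // [k|]; first exact/implyP.
  by rewrite (negPf nia).
Qed.

Lemma algorithm_E_correct (verbatim : bool) b : out_degree_le1 G ->
    (verbatim -> forall k i : V, edge k i -> avail k \subset avail i) ->
    algorithm_E verbatim q b ->
  b <-> exists s, nash s /\ consistent s q.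
Proof.
move=> deg1 sub [order /topological_from topo rn].
apply: (run_correct deg1 sub topo rn topo).
by split=> [i|i k|s _ _ i]; rewrite inE.
Qed.

End Runs.

(** * Timed loops and topological sorting *)

Section Loops.
Local Open Scope nat_scope.
Variables A B S : Type.
Implicit Types (s : seq A) (z : S).

Lemma foreach_cons a s z (body : S -> A -> timed S) :
  foreach (a :: s) z body =
  let! _ := op tt in let! z' := body z a in foreach s z' body.
Proof. by []. Qed.

Lemma outcome_foreach s z (body : S -> A -> timed S) :
  outcome (foreach s z body) = foldl (fun z a => outcome (body z a)) z s.
Proof. by elim: s z => //= a s IH z; rewrite IH. Qed.

Lemma outcome_tmap (f : A -> timed B) s :
  outcome (tmap f s) = [seq outcome (f a) | a <- s].
Proof. by elim: s => //= a s ->. Qed.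

Lemma outcome_tfilter (p : A -> timed bool) s :
  outcome (tfilter p s) = [seq a <- s | outcome (p a)].
Proof. by elim: s => //= a s ->. Qed.

Lemma cost_foreach s z (body : S -> A -> timed S) (c : A -> nat) :
    (forall z a, cost (body z a) <= c a) ->
  cost (foreach s z body) <= (\sum_(a <- s) (c a).+1).+1.
Proof.
move=> le; elim: s z => [|a s IH] z /=; first by rewrite big_nil.
by rewrite big_cons; have := IH (outcome (body z a)); have := le z a; lia.
Qed.

Lemma cost_foreach_const s z (body : S -> A -> timed S) c :
    (forall z a, cost (body z a) <= c) ->
  cost (foreach s z body) <= (c.+1 * size s).+1.
Proof.
move=> le; apply: leq_trans (cost_foreach s z (fun z a => le z a)) _.
by rewrite big_const_seq count_predT iter_addn_0.
Qed.

Lemma cost_tmap (f : A -> timed B) s c :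
  (forall a, cost (f a) <= c) -> cost (tmap f s) <= (c.+1 * size s).+1.
Proof. by move=> le; elim: s => //= a s IH; have := le a; nia. Qed.

Lemma cost_tfilter (p : A -> timed bool) s c :
  (forall a, cost (p a) <= c) -> cost (tfilter p s) <= (c.+1 * size s).+1.
Proof. by move=> le; elim: s => //= a s IH; have := le a; nia. Qed.

End Loops.

Lemma outcome_tsize A (s : seq A) : outcome (tsize s) = size s.
Proof.
rewrite /tsize outcome_foreach -[RHS]addn0; elim: s 0%N => //= a s IH n.
by rewrite IH addSnnS.
Qed.

Lemma cost_tsize A (s : seq A) : (cost (tsize s) <= (2 * size s).+1)%N.
Proof. exact: cost_foreach_const. Qed.

Section TopologicalSort.
Variable G : game.
Local Notation V := (node G).
Implicit Types (i j k : V) (deg : V -> nat) (todo : seq V) (done : {set V}).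

(** Take k in A with the fewest ancestors. A predecessor of k in A would have fewer: its ancestors
    are ancestors of k, and by acyclicity k is not among them. *)
Lemma acyclic_source (A : {set V}) : acyclic G -> A != set0 ->
  exists2 k, k \in A & forall j, edge j k -> j \notin A.
Proof.
move=> acyc /set0Pn[k0 k0A].
pose h k := #|[set j | connect (@edge G) j k]|.
case: (arg_minnP h k0A) => k kA min_k; exists k => // j jk.
apply/negP => /min_k; rewrite leqNgt => /negP[]; apply: proper_card.
apply/properP; split.
  by apply/subsetP => l; rewrite !inE => lj; apply: connect_trans lj (connect1 jk).
exists k; rewrite !inE ?connect0 //; apply/negP => /connectP[p kp jE].
have := acyc k (rcons p k); rewrite rcons_path kp -jE jk last_rcons eqxx.
by rewrite -size_eq0 size_rcons => /(_ isT isT).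
Qed.

Let release (st : (V -> nat) * seq V) k :=
  let: (deg, todo) := st in
  let! d := op (deg k).-1 in
  let! deg' := op (upd deg k d) in
  let! z := op (d == 0)%N in
  if z then op (deg', k :: todo) else ret (deg', todo).

Lemma release_foreach (s : seq V) deg todo (st := outcome (foreach s (deg, todo) release)) :
    uniq s -> uniq todo -> (forall k, k \in s -> k \notin todo) ->
  [/\ forall k, st.1 k = (deg k - (k \in s))%N, uniq st.2
    & forall k, (k \in st.2) = (k \in todo) || (k \in s) && (st.1 k == 0)%N].
Proof.
rewrite /st {st}; elim: s deg todo => [|i s IH] deg todo /=.
  by move=> _ uniq_todo _; split=> // k; rewrite ?subn0 ?orbF.
case/andP => nis uniq_s uniq_todo dis.
have [ito dis'] : i \notin todo /\ forall k, k \in s -> k \notin todo.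
  by split=> [|k ks]; apply: dis; rewrite inE ?eqxx ?ks ?orbT.
have updi k : (upd deg i (deg i).-1 k - (k \in s) = deg k - (k \in i :: s))%N.
  by rewrite /upd inE; have [->|_] := eqVneq k i; rewrite ?(negPf nis) ?subn0 ?subn1.
case: ifPn => deg_i /=.
  have [|k ks|E u mem] := IH (upd deg i (deg i).-1) (i :: todo) uniq_s.
  - by rewrite /= ito.
  - by rewrite inE negb_or dis' // andbT; apply: contraNneq nis => <-.
  split=> // [k|k]; first by rewrite E updi.
  rewrite mem !inE; have [->|//] := eqVneq k i.
  by rewrite E updi inE eqxx subn1 deg_i orbT.
have [E u mem] := IH (upd deg i (deg i).-1) todo uniq_s uniq_todo dis'.
split=> // [k|k]; first by rewrite E updi.
rewrite mem !inE; have [->|//] := eqVneq k i.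
by rewrite E updi inE eqxx subn1 (negPf deg_i) (negPf nis).
Qed.

Lemma mem_succs i k : (k \in succs i) = edge i k.
Proof. by rewrite mem_filter mem_enum andbT. Qed.

Let missing done k := #|[set j | edge j k & j \notin done]|.

Lemma kahn_topo fuel done deg todo : acyclic G ->
    (forall k, deg k = missing done k) -> uniq todo ->
    (forall k, (k \in todo) = (k \notin done) && (deg k == 0)%N) ->
    (forall k, k \in done -> deg k = 0%N) -> (#|~: done| <= fuel)%N ->
  topo_from done (outcome (kahn fuel deg todo)).
Proof.
move=> acyc; elim: fuel done deg todo => [|fuel IH] done deg todo degE uniq_todo mem_todo deg_done.
  by rewrite leqn0 cards_eq0 => /eqP d0; rewrite /= -[done]setCK d0 setC0.
case: todo uniq_todo mem_todo => [|i todo] /= uniq_todo mem_todo le_fuel.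
  (* If nodes remained, a source among them would have degree 0 and be a candidate. *)
  suff /eqP d0 : ~: done == set0 by rewrite -[done]setCK d0 setC0.
  apply/negPn/negP => /(acyclic_source acyc)[k].
  rewrite inE => kd src; have := mem_todo k; rewrite kd degE in_nil /= => /esym/negP[].
  rewrite cards_eq0; apply/eqP/setP => j; rewrite !inE.
  by apply/negP => /andP[/src]; rewrite inE negbK => ->.
case/andP: uniq_todo => ito uniq_todo.
have := mem_todo i; rewrite inE eqxx => /esym/andP[nid /eqP deg_i].
have deg_succ k : edge i k -> (0 < deg k)%N.
  by move=> ik; rewrite degE card_gt0; apply/set0Pn; exists i; rewrite inE ik.
have [||k|] := @release_foreach (succs i) deg todo.
- by rewrite filter_uniq ?enum_uniq.
- by [].
- rewrite mem_succs => /deg_succ; apply: contraTN => kt.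
  by have := mem_todo k; rewrite inE kt orbT => /esym/andP[_ /eqP ->].
rewrite -/release; case: (outcome (foreach _ _ release)) => deg' todo' /=.
have degE' k : (deg k - edge i k)%N = missing (i |: done) k.
  rewrite degE /missing [in LHS](cardsD1 i) !inE nid andbT addKn.
  by apply: eq_card => j; rewrite !inE negb_or andbCA.
move=> deg'E uniq' mem'; rewrite nid /=; apply/andP; split.
  apply/forallP => k; apply/implyP => ki; apply/negPn/negP => kd.
  have : k \in set0 by rewrite -(cards0_eq (etrans (esym (degE i)) deg_i)) inE ki.
  by rewrite inE.
apply: IH => // [k|k|k|].
- by rewrite deg'E mem_succs degE'.
- rewrite mem' !inE mem_succs; have := mem_todo k; rewrite inE.
  rewrite deg'E mem_succs; have [ek|ek] := boolP (edge i k).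
    have ki : k != i by apply: contraTneq ek => ->; rewrite edge_irr.
    rewrite (negPf ki) /=.
    have kd : k \notin done by apply/negP => /deg_done; have := deg_succ k ek; lia.
    by rewrite kd /=; have := deg_succ k ek; case: (k \in todo) => //=; lia.
  rewrite /= orbF subn0; have [-> _|ki /= ->//] := eqVneq k i.
  by rewrite (negPf ito).
- rewrite !inE deg'E => /predU1P[->|/deg_done ->//].
  by rewrite deg_i.
- by move: le_fuel; rewrite (cardsD1 i) inE nid /= add1n ltnS setCU setDE setIC.
Qed.

Lemma foldl_upd (f : V -> nat) (s : seq V) deg k :
  foldl (fun deg i => upd deg i (f i)) deg s k = if k \in s then f k else deg k.
Proof.
elim: s deg => //= i s IH deg; rewrite IH inE /upd.
by case: (k \in s); rewrite ?orbT ?orbF; have [->|] := eqVneq k i.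
Qed.

Lemma size_preds i : size (preds i) = #|[set j | edge j i]|.
Proof.
rewrite cardE {1}/enum_mem -enumT /preds !size_filter.
by apply: eq_count => j; rewrite /= inE.
Qed.

Lemma topsort_topo : acyclic G -> topo_from set0 (outcome (timed_topsort G)).
Proof.
move=> acyc; rewrite /timed_topsort /= outcome_foreach outcome_tfilter /=.
set deg := foldl _ _ _.
have degE k : deg k = missing set0 k.
  rewrite /deg (@foldl_upd (fun i => outcome (tsize (preds i)))).
  rewrite mem_enum outcome_tsize size_preds; apply: eq_card => j.
  by rewrite !inE /= andbT.
apply: kahn_topo => //.
- by rewrite filter_uniq ?enum_uniq.
- by move=> k; rewrite mem_filter mem_enum !inE andbT.
- by move=> k; rewrite inE.
- by rewrite setC0 cardsT.
Qed.

Lemma big_enum_nat (T : finType) (F : T -> nat) :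
  (\sum_(a <- enum T) F a = \sum_a F a)%N.
Proof. by rewrite big_enum; apply: eq_bigl. Qed.

Lemma size_succs i : out_degree_le1 G -> (size (succs i) <= 1)%N.
Proof.
move=> /(_ i); rewrite cardE {1}/enum_mem -enumT /succs !size_filter.
by rewrite (@eq_count _ _ (edge i)) // => j; rewrite /= inE.
Qed.

(** A node has at most one successor, so each round takes a bounded number of operations. *)
Lemma cost_kahn fuel deg todo : out_degree_le1 G ->
  (cost (kahn fuel deg todo) <= (8 * fuel).+1)%N.
Proof.
move=> deg1; elim: fuel deg todo => [|fuel IH] deg [|i todo] //=.
rewrite -/release; case E : (foreach _ _ release) => [[deg' todo'] c] /=.
have : (c <= 7)%N.
  have -> : c = cost (foreach (succs i) (deg, todo) release) by rewrite E.
  have le st k : (cost (release st k) <= 4)%N.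
    by case: st => deg1' todo1 /=; case: ifP.
  by have := cost_foreach_const (succs i) (deg, todo) le; have := size_succs i deg1; lia.
by have := IH deg' todo'; lia.
Qed.

(** Double counting of the edges: the in-degrees and the out-degrees have the same sum. *)
Lemma sum_size_preds : out_degree_le1 G -> (\sum_(i : V) size (preds i) <= #|V|)%N.
Proof.
move=> deg1; under eq_bigr => i _ do rewrite size_preds -sum1_card big_mkcond /=.
rewrite exchange_big -sum1_card leq_sum // => k _.
apply: leq_trans (deg1 k); rewrite -sum1_card [leqRHS]big_mkcond leq_sum // => i _.
by rewrite !inE.
Qed.

Lemma cost_topsort : out_degree_le1 G -> (cost (timed_topsort G) <= 20 * #|V|)%N.
Proof.
move=> deg1; rewrite /timed_topsort /=.
set deg := outcome (foreach _ _ _).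
have le1 z k : (cost (let! d := tsize (preds k) in op (upd z k d)) <= (2 * size (preds k)).+2)%N.
  by have := cost_tsize (preds k); rewrite /=; lia.
have := cost_foreach (enum V) (fun=> 0%N) le1.
rewrite big_enum_nat; under eq_bigr do rewrite -addn3.
rewrite big_split /= sum_nat_const -big_distrr /= => c1.
have := @cost_tfilter _ (fun i => op (deg i == 0)%N) (enum V) 1 (fun _ => isT).
rewrite -cardE => c2.
have c3 := cost_kahn #|V| deg (outcome (tfilter (fun i => op (deg i == 0)%N) (enum V))) deg1.
apply: leq_trans (leq_add (leqnn _) (leq_add c1 (leq_add c2 c3))) _.
move: (sum_size_preds deg1) (node_gt1 G); set n := #|V|; set e := (\sum_i _)%N.
by move: n e => n e; lia.
Qed.

End TopologicalSort.

(** * Augmenting paths *)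

(** The predicates may differ only at x. The additive form avoids truncated subtraction; it is
    applied when one slot is rematched. *)
Lemma count_change (T : eqType) (s : seq T) (a b : pred T) x :
    uniq s -> x \in s -> (forall y, y \in s -> y != x -> a y = b y) ->
  (count a s + b x = count b s + a x)%N.
Proof.
elim: s => //= y s IH /andP[nys uniq_s]; rewrite inE => /predU1P[->|xs] ab.
  rewrite (@eq_in_count _ a b) => [|z zs]; first by lia.
   apply: ab; first by rewrite inE zs orbT.
  by apply: contraNneq nys => <-.
have yx : y != x by apply: contraNneq nys => ->.
have abs z : z \in s -> z != x -> a z = b z.
  by move=> zs; apply: ab; rewrite inE zs orbT.
by have := IH uniq_s xs abs; rewrite (ab y) ?inE ?eqxx //; lia.
Qed.

Section Augmentation.
Local Open Scope nat_scope.
Variable G : game.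
Local Notation M := (colour G).
Local Notation left_vertex := (nat * {set M})%type.
Local Notation mates := (M -> nat -> option left_vertex).
Local Notation state := (bool * {set M} * mates)%type.
Variable classes : seq (M * nat).
Hypothesis uniq_classes : uniq (unzip1 classes).
Implicit Types (d : M) (x t : nat) (u v : left_vertex) (seen : {set M}).
Implicit Types (mate : mates) (cl : M * nat) (p : M * nat).

(** [try_slot] and [try_class] are the two loop bodies of [augment] with the recursive call
    abstracted, so that each loop has its own induction. *)
Definition try_slot (rec : left_vertex -> state -> timed state) d u
    (st : state) x : timed state :=
  let: (found, seen, mate) := st in
  if found then op st
  else
    let! w := op (mate d x) in
    if w is Some u' then
      let! (found', seen', mate') := rec u' (false, seen, mate) in
      if found' then op (true, seen', set_mate mate' d x u)
      else op (false, seen', mate')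
    else op (true, seen, set_mate mate d x u).

Definition try_class rec u (st : state) cl : timed state :=
  let: (found, seen, mate) := st in
  let: (d, t) := cl in
  let! b := op [&& ~~ found, d \in u.2 & d \notin seen] in
  if b then
    let! seen' := op (d |: seen) in
    foreach (iota 1 t) (false, seen', mate) (try_slot rec d u)
  else op st.

Lemma augmentS fuel u st :
  augment fuel.+1 classes u st =
  foreach classes st (try_class (augment fuel classes) u).
Proof. by []. Qed.

Definition slots := [seq (cl.1, x) | cl <- classes, x <- iota 1 cl.2].

Definition occ mate v := count (fun p => mate p.1 p.2 == Some v) slots.

Definition legal mate := forall d x v, mate d x = Some v -> d \in v.2.

Definition covered v seen := forall d, d \in unzip1 classes -> d \in v.2 -> d \in seen.

Definition saturated mate seen p :=
  exists2 v, mate p.1 p.2 = Some v & covered v seen.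

(** Colours already in [seen] at the start are excluded: an enclosing call may still be working
    through their slots. *)
Definition closed_from mate seen seen' :=
  forall p, p \in slots -> p.1 \in seen' -> p.1 \notin seen -> saturated mate seen' p.

(* While a search unwinds, the left vertex to be moved is matched twice; counting
   the slots of each left vertex covers these intermediate states. *)
Definition augmented u seen mate mate' :=
  [/\ forall v, occ mate' v = occ mate v + (v == u), legal mate'
    & forall d x, d \in seen -> mate' d x = mate d x].

(** The cost of one call apart from the classes it explores: three operations per class and one to
    end the loop. *)
Let B := (3 * size classes).+1.

(* The cost of exploring the class cl; each matched slot in it leads to one nested
   call, whose own cost is B apart from the classes that it explores. *)
Definition weight mate cl :=
  (3 * cl.2 + B * count (fun x => isSome (mate cl.1 x)) (iota 1 cl.2)).+1.

(** An amortised budget: the weight of a class is spent once, when its colour enters [seen]. *)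
Definition potential mate seen := \sum_(cl <- classes | cl.1 \notin seen) weight mate cl.

Definition unseen seen := count (fun cl => cl.1 \notin seen) classes.

Lemma slotP p : reflect (exists2 t, (p.1, t) \in classes & p.2 \in iota 1 t) (p \in slots).
Proof.
apply: (iffP allpairsPdep) => [[cl [x [clc xt ->]]]|[t pc pt]].
  by exists cl.2 => //=; rewrite -surjective_pairing.
by exists (p.1, t), p.2; split=> //=; case: (p).
Qed.

Lemma uniq_slots : uniq slots.
Proof.
apply: allpairs_uniq_dep => [|cl _|[cl x] [cl' x'] /=]; first exact: map_uniq uniq_classes.
  exact: iota_uniq.
case/allpairsPdep => [cl1 [x1 [c1 _ [-> ->]]]] /allpairsPdep[cl2 [x2 [c2 _ [-> ->]]]] [e ->].
by rewrite (uniq_map_inj_in uniq_classes c1 c2 e).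
Qed.

Lemma occ_set_mate mate d x u v : (d, x) \in slots ->
  occ (set_mate mate d x u) v + (mate d x == Some v) = occ mate v + (v == u).
Proof.
move=> dx; have := count_change (a := fun p => set_mate mate d x u p.1 p.2 == Some v)
  (b := fun p => mate p.1 p.2 == Some v) uniq_slots dx.
rewrite /occ /= => -> => [|[d' x'] _ /=].
  by rewrite /set_mate /upd !eqxx; congr (_ + nat_of_bool _); apply/eqP/eqP => [[->]|->].
rewrite xpair_eqE negb_and /set_mate /upd.
by have [->|//] := eqVneq d' d; rewrite /= => /negPf ->.
Qed.

Lemma legal_set_mate mate d x u : legal mate -> d \in u.2 -> legal (set_mate mate d x u).
Proof.
move=> leg du d' x' v; rewrite /set_mate /upd.
have [->|_] := eqVneq d' d; last exact: leg.
by case: eqP => [_ [<-]//|_]; apply: leg.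
Qed.

Lemma set_mate_ne mate d x u d' x' : d' != d -> set_mate mate d x u d' x' = mate d' x'.
Proof. by rewrite /set_mate /upd => /negPf ->. Qed.

Lemma covered_sub v seen seen' : seen \subset seen' -> covered v seen -> covered v seen'.
Proof. by move=> sub cov d dc /(cov d dc); apply: (subsetP sub). Qed.

Lemma saturated_sub mate seen seen' p :
  seen \subset seen' -> saturated mate seen p -> saturated mate seen' p.
Proof. by move=> sub [v pv cov]; exists v => //; apply: covered_sub cov. Qed.

Lemma closed_from_trans mate seen1 seen2 seen3 : seen2 \subset seen3 ->
    closed_from mate seen1 seen2 -> closed_from mate seen2 seen3 ->
  closed_from mate seen1 seen3.
Proof.
move=> sub c12 c23 p ps p3 p1; have [p2|p2] := boolP (p.1 \in seen2); last exact: c23.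
exact: saturated_sub sub (c12 p ps p2 p1).
Qed.

Lemma potential_setU1 mate d t seen : (d, t) \in classes -> d \notin seen ->
  potential mate seen = weight mate (d, t) + potential mate (d |: seen).
Proof.
move=> dc ds; have uniq_cl := map_uniq uniq_classes.
rewrite /potential !(big_mkcond (fun cl => cl.1 \notin _)) /= !(bigD1_seq (d, t)) //=.
rewrite ds setU11 add0n big_seq_cond [in RHS]big_seq_cond; congr addn.
apply: eq_bigr => cl /andP[clc clne]; rewrite in_setU1 negb_or.
suff -> : cl.1 != d by [].
by apply: contraNneq clne => e; rewrite (uniq_map_inj_in uniq_classes clc dc e).
Qed.

Lemma unseen_lt d t seen seen' : (d, t) \in classes -> d \notin seen -> d \in seen' ->
  seen \subset seen' -> unseen seen' < unseen seen.
Proof.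
move=> dc ds ds' sub; pose a := [pred cl : M * nat | cl.1 \notin seen'].
have := count_predUI a (pred1 (d, t)) classes.
rewrite [X in _ + X](@eq_count _ _ pred0) => [|cl /=]; last first.
  by apply/negP => /andP[cls /eqP ecl]; rewrite ecl ds' in cls.
have : 0 < count (pred1 (d, t)) classes by rewrite -has_count has_pred1.
have : count (predU a (pred1 (d, t))) classes <= unseen seen.
  by apply: sub_count => cl /= /orP[|/eqP ->//]; apply: contra; apply: (subsetP sub).
rewrite count_pred0 addn0 => le pos E; rewrite E in le; apply: leq_trans le.
by rewrite -addn1 leq_add2l.
Qed.

(** Both potentials refer to the matching before the search. This is sound because a failed search
    leaves the matching unchanged and a successful one explores nothing after its first change. *)
Definition search_spec u seen mate (r : timed state) :=
  let: (found, seen', mate') := outcome r in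
  [/\ seen \subset seen',
      if found then augmented u seen mate mate'
      else [/\ mate' = mate, closed_from mate seen seen' & covered u seen']
    & cost r + potential mate seen' <= B + potential mate seen].

Section Search.
Variable rec : left_vertex -> state -> timed state.
Variable fuel : nat.
Hypothesis recP : forall u seen mate, unseen seen < fuel -> legal mate ->
  search_spec u seen mate (rec u (false, seen, mate)).
Variables (u : left_vertex) (seen0 : {set M}) (mate : mates).
Hypotheses (legal_mate : legal mate) (enough : unseen seen0 <= fuel).

(** [seen0] is the set of explored colours when the search from u began. As d has entered [seen]
    since, nested searches have strictly fewer unseen classes, which is what their fuel requires,
    and they cannot alter the slots of d. *)
Lemma try_slotsP d t xs found seen mate' :
    (d, t) \in classes -> d \in u.2 -> d \notin seen0 -> {subset xs <= iota 1 t} ->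
    seen0 \subset seen -> d \in seen ->
    (if found then augmented u seen0 mate mate' else mate' = mate) ->
  let r := foreach xs (found, seen, mate') (try_slot rec d u) in
  let: (found1, seen1, mate1) := outcome r in
  [/\ seen \subset seen1,
      if found1 then augmented u seen0 mate mate1
      else [/\ ~~ found, mate1 = mate, closed_from mate seen seen1
             & forall x, x \in xs -> saturated mate seen1 (d, x)]
    & cost r + potential mate seen1 <=
      (3 * size xs + B * count (fun x => isSome (mate d x)) xs).+1 + potential mate seen].
Proof.
move=> dc du ds0; elim: xs found seen mate' => [|x xs IH] found seen mate' sub_xs sub0 ds inv /=.
  split=> //; last by lia.
  case: found inv => // ->; split=> // p ps p1; by rewrite p1.
have sub_xs' : {subset xs <= iota 1 t} by move=> y ys; apply: sub_xs; rewrite inE ys orbT.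
have dx : (d, x) \in slots by apply/slotP; exists t => //; apply: sub_xs; rewrite inE eqxx.
case: found inv => [aug|->] /=.
  have := IH true seen mate' sub_xs' sub0 ds aug.
  case: (foreach _ _ _) => [[[found1 seen1] mate1] c] /= [sub inv le].
  split=> //; last by lia.
  by case: found1 inv => // -[].
have ds0' d' : d' \in seen0 -> d' != d by move=> d's; apply: contraNneq ds0 => <-.
case E : (mate d x) => [u'|] /=; last first.
  have aug : augmented u seen0 mate (set_mate mate d x u).
    split=> [v||d' x' /ds0' d'd]; last by rewrite set_mate_ne.
    - by have := occ_set_mate mate u v dx; rewrite E addn0.
    - exact: legal_set_mate.
  have := IH true seen _ sub_xs' sub0 ds aug.
  case: (foreach _ _ _) => [[[found1 seen1] mate1] c] /= [sub inv le].
  split=> //; last by lia.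
  by case: found1 inv => // -[].
have lt : unseen seen < fuel by apply: leq_trans enough; apply: unseen_lt dc ds0 ds sub0.
have := recP u' lt legal_mate.
case: (rec _ _) => [[[found2 seen2] mate2] c2]; rewrite /search_spec /=.
case: found2 => /= -[sub2 inv2 le2].
  (* The nested search gave u' a second slot and left (d, x) to it; passing (d, x) on to u restores
     the count of u' and raises that of u. *)
  have aug : augmented u seen0 mate (set_mate mate2 d x u).
    case: inv2 => occ2 leg2 frame2; split=> [v||d' x' d's].
    - have := occ_set_mate mate2 u v dx; rewrite occ2 frame2 // E.
      have -> : (Some u' == Some v) = (v == u') by apply/eqP/eqP => [[]|->].
      by lia.
    - exact: legal_set_mate.
    - by rewrite set_mate_ne ?ds0' // frame2 // (subsetP sub0).
  have := IH true seen2 _ sub_xs' (subset_trans sub0 sub2) (subsetP sub2 _ ds) aug.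
  case: (foreach _ _ _) => [[[found1 seen1] mate1] c] /= [sub inv le].
  split=> //; [exact: subset_trans sub| |by lia].
  by case: found1 inv => // -[].
case: inv2 => -> closed2 cov2.
have := IH false seen2 mate sub_xs' (subset_trans sub0 sub2) (subsetP sub2 _ ds) erefl.
case: (foreach _ _ _) => [[[found1 seen1] mate1] c] /= [sub inv le].
split=> //; [exact: subset_trans sub| |by lia].
case: found1 inv => // -[_ -> closed1 sat1]; split=> //.
  exact: closed_from_trans sub closed2 closed1.
move=> y; rewrite inE => /predU1P[->|/sat1 //].
by apply: saturated_sub sub _; exists u'.
Qed.

Lemma try_classesP cls found seen mate' :
    {subset cls <= classes} -> seen0 \subset seen ->
    (if found then augmented u seen0 mate mate'
     else mate' = mate /\ closed_from mate seen0 seen) ->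
  let r := foreach cls (found, seen, mate') (try_class rec u) in
  let: (found1, seen1, mate1) := outcome r in
  [/\ seen \subset seen1,
      if found1 then augmented u seen0 mate mate1
      else [/\ ~~ found, mate1 = mate, closed_from mate seen0 seen1
             & forall cl, cl \in cls -> cl.1 \in u.2 -> cl.1 \in seen1]
    & cost r + potential mate seen1 <= (3 * size cls).+1 + potential mate seen].
Proof.
elim: cls found seen mate' => [|[d t] cls IH] found seen mate' sub_cls sub0 inv /=.
  by split=> //; case: found inv => // -[-> ?].
have sub_cls' : {subset cls <= classes} by move=> y ys; apply: sub_cls; rewrite inE ys orbT.
have dc : (d, t) \in classes by apply: sub_cls; rewrite inE eqxx.
case: ifPn => [/and3P[nf du dseen]|skip] /=; last first.
  have := IH found seen mate' sub_cls' sub0 inv.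
  case: (foreach _ _ _) => [[[found1 seen1] mate1] c] /= [sub inv1 le].
  split=> //; last by lia.
  case: found1 inv1 => // -[nf ? ? cov]; split=> // cl; rewrite inE => /predU1P[-> /= du|/cov //].
  by apply: (subsetP sub); move: skip; rewrite nf du negbK.
case: found nf inv => // _ [-> closed].
have ds0 : d \notin seen0 by apply: contra dseen; apply: (subsetP sub0).
have := @try_slotsP d t (iota 1 t) false (d |: seen) mate dc du ds0 (fun _ => id)
  (subset_trans sub0 (subsetUr _ _)) (setU11 _ _) erefl.
rewrite size_iota.
case: (foreach (iota 1 t) _ _) => [[[found2 seen2] mate2] c2] /= [sub2 inv2 le2].
have sub02 : seen \subset seen2 by apply: subset_trans (subsetUr _ _) sub2.
have d2 : d \in seen2 by apply: (subsetP sub2); rewrite setU11.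
have pot := potential_setU1 mate dc dseen; rewrite /weight /= in pot.
have := IH found2 seen2 mate2 sub_cls' (subset_trans sub0 sub02).
have inv2' : if found2 then augmented u seen0 mate mate2
    else mate2 = mate /\ closed_from mate seen0 seen2.
  (* The colour of p is d, all of whose slots were tried, or was explored by an earlier class, or
     entered during the exploration of d. *)
  case: found2 inv2 => // -[_ -> closed2 sat]; split=> // p ps p2 p0.
  have [p1|np1] := boolP (p.1 \in d |: seen); last exact: closed2.
  case/setU1P: p1 => [pd|p1]; last exact: saturated_sub sub02 (closed p ps p1 p0).
  have [t' pc pt] := slotP _ ps; rewrite [p]surjective_pairing pd; apply: sat.
  rewrite pd in pc; have [<-//] := uniq_map_inj_in uniq_classes pc dc erefl.
move=> /(_ inv2').
case: (foreach cls _ _) => [[[found1 seen1] mate1] c] /= [sub inv1 le].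
split=> //; [exact: subset_trans sub| |by lia].
case: found1 inv1 => // -[_ ? ? cov]; split=> // cl; rewrite inE => /predU1P[-> /= _|/cov //].
exact: (subsetP sub).
Qed.

End Search.

Lemma augmentP fuel u seen mate : unseen seen < fuel -> legal mate ->
  search_spec u seen mate (augment fuel classes u (false, seen, mate)).
Proof.
elim: fuel u seen mate => // fuel IH u seen mate lt leg; rewrite augmentS.
have := @try_classesP (augment fuel classes) fuel IH u seen mate leg lt
  classes false seen mate (fun _ => id) (subxx _).
have triv : closed_from mate seen seen by move=> p _ ->.
move=> /(_ (conj erefl triv)); rewrite /search_spec.
case: (foreach _ _ _) => [[[found1 seen1] mate1] c] /= [sub inv le]; split=> //.
case: found1 inv => // -[_ -> closed cov]; split=> // d /mapP[cl clc ->]; exact: cov.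
Qed.

End Augmentation.

(** * Maximum matchings *)

Lemma count_mem_pmap (A : Type) (B : eqType) (f : A -> option B) (s : seq A) b :
  count_mem b (pmap f s) = count (fun a => f a == Some b) s.
Proof. by elim: s => //= a s IH; case: (f a) => //= c; rewrite IH. Qed.

Lemma uniq_count_le1 (T : eqType) (s : seq T) :
  (forall x, (count_mem x s <= 1)%N) -> uniq s.
Proof.
move=> le1; apply: count_mem_uniq => x.
by have := le1 x; rewrite -has_pred1 has_count; case: (count_mem x s) => [|[]].
Qed.

Lemma zip_map_self (A B : Type) (f : A -> B) (s : seq A) :
  zip s (map f s) = [seq (a, f a) | a <- s].
Proof. by elim: s => //= a s ->. Qed.

Section MaximumMatching.
Local Open Scope nat_scope.
Variable G : game.
Local Notation M := (colour G).
Local Notation left_vertex := (nat * {set M})%type.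
Local Notation mates := (M -> nat -> option left_vertex).
Variables (slack : M -> int) (D : {set M}) (Y : seq {set M}) (classes : seq (M * nat)).
Hypothesis uniq_classes : uniq (unzip1 classes).
Hypothesis mem_slots : forall p, (p \in slots classes) =
  [&& p.1 \in D, 0 < p.2 & (p.2%:Z <= slack p.1)%R].
Implicit Types (d : M) (x t : nat) (u v : left_vertex) (seen : {set M}).
Implicit Types (mate : mates) (cl : M * nat) (p : M * nat).

Local Notation y := (size Y).
Local Notation adj := (bip_adj slack D Y).

Definition left_vertices : seq left_vertex := zip (iota 0 y) Y.

Lemma left_verticesE : left_vertices = [seq (z, nth set0 Y z) | z <- iota 0 y].
Proof. by rewrite -zip_map_self -/(mkseq _ _) mkseq_nth. Qed.

Lemma uniq_left_vertices : uniq left_vertices.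
Proof. by rewrite left_verticesE map_inj_uniq ?iota_uniq // => z z' []. Qed.

Lemma left_vertexP u : u \in left_vertices -> u.1 < y /\ u.2 = nth set0 Y u.1.
Proof.
by rewrite left_verticesE => /mapP[z]; rewrite mem_iota /= add0n => lt ->.
Qed.

Lemma adjE z p : adj z p = [&& z < y, p \in slots classes & p.1 \in nth set0 Y z].
Proof. by rewrite mem_slots /bip_adj -!andbA. Qed.

Lemma slot_class p : p \in slots classes -> p.1 \in unzip1 classes.
Proof. by case/(slotP) => t /(map_f fst). Qed.

(** [R] lists the slots of the explored colours and [W] consists of u and their partners. [W] has
    one element more than [R], while all its neighbours lie in [R]. *)
Lemma hall_violation mate u seen :
    (forall v, occ classes mate v <= (v \in left_vertices)) ->
    u \in left_vertices -> occ classes mate u = 0 ->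
    closed_from classes mate set0 seen -> covered classes u seen ->
  forall nu, matching adj nu -> size nu < y.
Proof.
move=> occ_le uY occ_u closed cov nu mat_nu.
rewrite ltn_neqAle (size_matching mat_nu) andbT; apply/negP => /eqP sz.
case/and3P: mat_nu => uniq1 uniq2 /allP adj_nu.
pose R := [seq p <- slots classes | p.1 \in seen].
pose mate1 p := mate p.1 p.2.
have satR p : p \in R -> saturated classes mate seen p.
  by rewrite mem_filter => /andP[ps pcl]; apply: closed; rewrite ?inE.
pose W := u :: pmap mate1 R.
have sizeW : size W = (size R).+1.
  rewrite /= size_pmap; congr _.+1; apply/eqP; rewrite -all_count; apply/allP => p /satR.
  by case=> v; rewrite /mate1 => ->.
have occR v : count_mem v (pmap mate1 R) <= occ classes mate v.
  by rewrite count_mem_pmap /occ count_filter; apply: sub_count => p /andP[].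
have uniqW : uniq W.
  rewrite /= -has_pred1 has_count -leqNgt (leq_trans (occR u)) ?occ_u //=.
  by apply: uniq_count_le1 => v; apply: leq_trans (occR v) (leq_trans (occ_le v) (leq_b1 _)).
have memW w : w \in W -> w \in left_vertices /\ covered classes w seen.
  rewrite inE => /predU1P[->//|wR]; split.
    have := leq_trans (occR w) (occ_le w); rewrite -has_pred1 in wR.
    by rewrite has_count in wR; case: (w \in left_vertices) => //; lia.
  move: wR; rewrite mem_pmap => /mapP[p /satR[v pv covv]].
  by rewrite /mate1 pv => -[->].
(* If [nu] had size |Y|, it would cover [W], and its edges there would end in distinct slots of
   [R]. *)
pose nuW := [seq e <- nu | e.1 \in map fst W].
have le1 : size W <= size nuW.
  rewrite -(size_map fst W) -(size_map fst nuW); apply: uniq_leq_size.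
    rewrite map_inj_in_uniq // => w w'.
    move=> /memW[/left_vertexP[_ e] _] /memW[/left_vertexP[_ e'] _] ww'.
    by rewrite [w]surjective_pairing [w']surjective_pairing e e' ww'.
  move=> _ /mapP[w wW ->]; have [/left_vertexP[lt _] _] := memW w wW.
  have : w.1 \in unzip1 nu.
    have -> : unzip1 nu =i iota 0 y; last by rewrite mem_iota.
    apply: (uniq_min_size uniq1 _ _).2; last by rewrite size_iota size_map sz.
    by move=> z /mapP[e /adj_nu]; rewrite adjE => /and3P[ltz _ _] ->; rewrite mem_iota.
  case/mapP => e enu we; apply/mapP; exists e => //.
  by rewrite mem_filter enu -we map_f.
have le2 : size nuW <= size R.
  rewrite -(size_map snd nuW); apply: uniq_leq_size.
    rewrite map_inj_in_uniq ?filter_uniq ?(map_uniq uniq1) // => e e'.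
    rewrite !mem_filter => /andP[_ enu] /andP[_ e'nu]; exact: (uniq_map_inj_in uniq2).
  move=> _ /mapP[e + ->]; rewrite mem_filter => /andP[/mapP[w wW ew] /adj_nu].
  rewrite adjE mem_filter => /and3P[_ es ey]; rewrite es andbT.
  have [/left_vertexP[_ w2] covw] := memW w wW.
  by apply: covw; rewrite ?slot_class // w2 -ew.
by have := leq_trans le1 le2; rewrite sizeW ltnn.
Qed.

(** Each left vertex takes the first slot that holds it. Distinct vertices get distinct slots since
    a slot holds one vertex, and [legal] gives adjacency. *)
Lemma perfect_matching mate : legal mate ->
    (forall v, v \in left_vertices -> 0 < occ classes mate v) ->
  exists2 mu, matching adj mu & size mu = y.
Proof.
move=> leg occ_gt0.
pose a v p := mate p.1 p.2 == Some v.
have slot_of v : v \in left_vertices -> has (a v) (slots classes).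
  by move=> /occ_gt0; rewrite has_count.
have [c0 _] : exists c : M, c \in [set: M].
  have /card_gt0P[i _] := ltnW (node_gt1 G).
  by have /set0Pn[c _] := avail_neq0 i; exists c; rewrite inE.
pose p0 : M * nat := (c0, 0).
pose f v := nth p0 (slots classes) (find (a v) (slots classes)).
have fP v : v \in left_vertices -> f v \in slots classes /\ mate (f v).1 (f v).2 = Some v.
  move=> /slot_of has_v; split; first by rewrite mem_nth // -has_find.
  exact/eqP/(nth_find p0 has_v).
exists [seq (v.1, f v) | v <- left_vertices]; last first.
  by rewrite size_map left_verticesE size_map size_iota.
apply/and3P; split.
- by rewrite /unzip1 -map_comp left_verticesE -map_comp map_id_in ?iota_uniq.
- rewrite /unzip2 -map_comp map_inj_in_uniq ?uniq_left_vertices //.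
  move=> v v' /fP[_ e] /fP[_ e'] /= ff'.
  by move: e; rewrite ff' e' => -[].
- apply/allP => _ /mapP[v vY ->]; have [fs fv] := fP v vY.
  have [lt v2] := left_vertexP vY.
  by rewrite adjE /= lt fs -v2 (leg _ _ _ fv).
Qed.

(** The searches are only shown to decide whether size |Y| is attained; the maximum matching that
    [tested] asks for exists because sizes are bounded by |Y|. *)
Lemma exists_maximum_matching : exists mu, maximum_matching adj mu.
Proof.
pose P n := `[< exists2 mu, matching adj mu & size mu = n >].
have exP : exists n, P n by exists 0; apply/asboolP; exists [::].
have leP n : P n -> n <= y by case/asboolP => mu /size_matching le <-.
case: (ex_maxnP exP leP) => _ /asboolP[mu mat <-] max_mu; exists mu; split=> // nu mat_nu.
by apply: max_mu; apply/asboolP; exists nu.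
Qed.

Lemma count_slots mate :
  count (fun p => isSome (mate p.1 p.2)) (slots classes) =
  \sum_(cl <- classes) count (fun x => isSome (mate cl.1 x)) (iota 1 cl.2).
Proof.
rewrite /slots; elim: (classes) => [|cl cls IH]; first by rewrite big_nil.
by rewrite big_cons /= count_cat IH count_map.
Qed.

(** Matched slots hold distinct members of [r], so at most [size r] nested calls are budgeted over
    all classes together. *)
Lemma potential_le mate r t : (forall cl, cl \in classes -> cl.2 <= t) ->
    (forall v, occ classes mate v <= (v \in r)) ->
  potential classes mate set0 <= size classes * (3 * t).+1 + (3 * size classes).+1 * size r.
Proof.
move=> le_t occ_le.
have matched : count (fun p => isSome (mate p.1 p.2)) (slots classes) <= size r.
  rewrite -(size_pmap (fun p => mate p.1 p.2)); apply: uniq_leq_size => [|v].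
    by apply: uniq_count_le1 => v; rewrite count_mem_pmap (leq_trans (occ_le v)) ?leq_b1.
  rewrite -has_pred1 has_count count_mem_pmap => pos.
  by have := leq_trans pos (occ_le v); case: (v \in r).
apply: leq_trans (leq_add (leqnn _) (leq_mul (leqnn _) matched)).
rewrite count_slots /potential big_mkcond /= big_distrr /= -[size classes * _]mulnC.
rewrite -(@sum1_size _ classes) big_distrr /= -big_split /=.
rewrite big_seq [leqRHS]big_seq leq_sum // => cl clc; rewrite inE /= /weight sum1_size.
by rewrite muln1 -addSn leq_add2r ltnS leq_mul2l le_t.
Qed.

Local Arguments augment {G} fuel classes u st : simpl never.

Definition search_round u (st : nat * mates) :=
  let: (n, mate) := st in
  let! seen := fill #|M| set0 in
  let! (found, _, mate') :=
    augment (size classes).+1 classes u (false, seen, mate) in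
  if found then op (n.+1, mate') else op (n, mate').

(** The terms pay for the table [seen], for the root call and at most t nested calls, for the slots
    of the classes, and for the final operation. *)
Definition round_cost t :=
  (#|M| + (3 * size classes).+1 * (t + 1) + size classes * (3 * t).+1).+1.

(** Here n counts successes. Either every search so far succeeded and every treated vertex is
    matched, or one failed, and the bound on all matchings obtained then remains valid however the
    matching evolves. *)
Definition rounds_invariant (us : seq left_vertex) n mate :=
  [/\ legal mate, forall v, occ classes mate v <= (v \in us),
      n <= size us,
      n = size us -> forall v, v \in us -> 0 < occ classes mate v
    & n < size us -> forall nu, matching adj nu -> size nu < y].

Lemma search_roundP (us : seq left_vertex) u n mate :
    {subset rcons us u <= left_vertices} -> u \notin us -> rounds_invariant us n mate ->
    (forall cl, cl \in classes -> cl.2 <= y) -> size us <= y ->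
  let r := search_round u (n, mate) in
  rounds_invariant (rcons us u) (outcome r).1 (outcome r).2 /\ cost r <= round_cost y.
Proof.
move=> sub uus [leg occ_le n_le full fail] le_y us_y.
have enough : unseen classes set0 < (size classes).+1 by rewrite ltnS count_size.
have := augmentP uniq_classes u enough leg; rewrite /search_spec /search_round /=.
have uY : u \in left_vertices by apply: sub; rewrite mem_rcons inE eqxx.
have pot := potential_le le_y occ_le.
have occ_u : occ classes mate u = 0 by have := occ_le u; rewrite (negPf uus); case: occ.
case: (@augment G _ _ _ _) => [[[found seen] mate'] c] /= [_ post le].
have le_c : c <= (3 * size classes).+1 * (y + 1) + size classes * (3 * y).+1.
  rewrite mulnDr muln1.
  have : (3 * size classes).+1 * size us <= (3 * size classes).+1 * y by rewrite leq_mul2l us_y.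
  move: le pot; set a := _ * size us; set b := _.+1 * y; set d := size classes * _; set e := _.+1.
  by move: a b d e => a b d e; clear; lia.
have cost_le : #|M| + (c + 1) <= round_cost y.
  by rewrite /round_cost addn1 addnS ltnS -[leqRHS]addnA leq_add2l.
case: found post => [[occ' leg' _]|[-> closed cov]] /=; split=> //.
- split=> //= [v|||].
  + rewrite occ' mem_rcons inE; have := occ_le v.
    by have [->|_] := eqVneq v u; [rewrite occ_u|rewrite addn0].
  + by rewrite size_rcons.
  + rewrite size_rcons => -[/full pos] v; rewrite mem_rcons inE occ'.
    by case/predU1P => [->|/pos]; rewrite ?eqxx; lia.
  + by rewrite size_rcons ltnS => /fail.
- split=> //= [v|||].
  + by rewrite mem_rcons inE (leq_trans (occ_le v)) //; case: (v \in us); rewrite ?orbT.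
  + by rewrite size_rcons leqW.
  + by rewrite size_rcons => e; rewrite e ltnn in n_le.
  + move=> _; apply: hall_violation uY occ_u closed cov => v.
    apply: leq_trans (occ_le v) _; have [vu|//] := boolP (v \in us).
    by rewrite sub // mem_rcons inE vu orbT.
Qed.

Lemma search_roundsP (us us' : seq left_vertex) n mate :
    us ++ us' = left_vertices -> rounds_invariant us n mate ->
    (forall cl, cl \in classes -> cl.2 <= y) ->
  let r := foreach us' (n, mate) (fun st u => search_round u st) in
  rounds_invariant left_vertices (outcome r).1 (outcome r).2 /\
  cost r <= ((round_cost y).+1 * size us').+1.
Proof.
move=> + + le_y; elim: us' us n mate => [|u us' IH] us n mate usE inv.
  by rewrite /= -usE cats0 muln0.
have [sz_us sub uus] : [/\ size us <= y, {subset rcons us u <= left_vertices} & u \notin us].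
  split.
  - have := congr1 size usE; rewrite size_cat left_verticesE size_map size_iota.
    by move=> <-; rewrite leq_addr.
  - by move=> v; rewrite -usE -cat_rcons mem_cat => ->.
  - by have := uniq_left_vertices; rewrite -usE cat_uniq /= => /and3P[_ /norP[]].
have [] := search_roundP sub uus inv le_y sz_us.
rewrite foreach_cons; case: (search_round u (n, mate)) => [[n1 mate1] c1] /= inv1 le1.
have [] := IH _ n1 mate1 _ inv1; first by rewrite cat_rcons.
case: (foreach _ _ _) => [[n2 mate2] c2] /= inv2 le2; split=> //.
by rewrite mulnS; lia.
Qed.

(** The test compares the result with |Y| only, so agreement with a maximum matching on this
    comparison suffices. *)
Lemma timed_matching_sizeP (r := timed_matching_size classes Y) :
    (forall cl, cl \in classes -> cl.2 <= y) ->
  (exists2 mu, maximum_matching adj mu & (outcome r == y) = (size mu == y)) /\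
  cost r <= 3 * y + #|M| * y.+1 + 2 * size classes + (round_cost y).+1 * y + 3.
Proof.
move=> le_y.
have inv0 : rounds_invariant [::] 0 (fun (_ : M) (_ : nat) => None).
  by split=> // v; rewrite /occ count_pred0.
have := search_roundsP (us := [::]) erefl inv0 le_y.
rewrite /r {r} /timed_matching_size /= !outcome_tsize -/left_vertices.
pose F := foreach left_vertices (0, fun _ _ => None) (fun st u => search_round u st).
rewrite -/F; case: F => [[n mate] c] /= [[leg occ_le n_le full fail] cost_le].
have size_lv : size left_vertices = y by rewrite left_verticesE size_map size_iota.
rewrite size_lv in n_le full fail cost_le; split; last first.
  have := cost_tsize Y; have := cost_tsize classes; move: cost_le.
  by move: (round_cost y).+1 => z; lia.
have [mu max_mu] := exists_maximum_matching; exists mu => //.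
have [eq_ny|ne_ny] := eqVneq n y.
  have [nu mat_nu sz_nu] := perfect_matching leg (full eq_ny).
  by rewrite eqn_leq (size_matching max_mu.1) -sz_nu max_mu.2.
apply/esym/negbTE; rewrite neq_ltn fail ?max_mu.1 //.
by rewrite ltn_neqAle ne_ny.
Qed.

End MaximumMatching.

(** * The timed procedure *)

Lemma outcome_tsubset (M : finType) (Z A : {set M}) :
  outcome (tsubset Z A) = (Z \subset A).
Proof.
rewrite /tsubset outcome_foreach /=.
have E (s : seq M) b :
    foldl (fun b d => b && ((d \in Z) ==> (d \in A))) b s =
    b && all (fun d => (d \in Z) ==> (d \in A)) s.
  by elim: s b => [|d s IH] b /=; rewrite ?andbT // IH andbA.
rewrite E /=; apply/allP/subsetP => [sub d dZ|sub d _]; last exact/implyP/sub.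
exact: implyP (sub d (mem_enum _ _)) dZ.
Qed.

Lemma cost_tsubset (M : finType) (Z A : {set M}) :
  (cost (tsubset Z A) <= (2 * #|M|).+1)%N.
Proof. by rewrite cardE; apply: cost_foreach_const. Qed.


Local Arguments timed_prune {G} slack D Y : simpl never.

Section TimedTest.
Variable G : game.
Local Notation V := (node G).
Local Notation M := (colour G).
Implicit Types (i : V) (c d : M) (C D s : seq M) (Y : seq {set M}) (Z : {set M}).

Let by_bonus i : rel M := fun c d => bonus i c <= bonus i d.

Lemma insertP i c s :
  [/\ perm_eq (outcome (insert i c s)) (c :: s),
      pairwise (by_bonus i) s -> pairwise (by_bonus i) (outcome (insert i c s))
    & (cost (insert i c s) <= (2 * size s).+1)%N].
Proof.
elim: s => [|d s [perm_s pair_s cost_s]] //=; case: ifPn => /= cd; split.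
- by [].
- case/andP => all_d pair; rewrite [by_bonus i c d]cd all_d pair !andbT /=.
  by apply: sub_all all_d => e; apply: le_trans.
- by lia.
- by rewrite -(perm_cons d) in perm_s; apply: (perm_trans perm_s); apply/permP => a /=; lia.
- case/andP => all_d /pair_s ->; rewrite (perm_all _ perm_s) /= all_d !andbT.
  by rewrite /by_bonus ltW // ltNge.
- by lia.
Qed.

Lemma timed_sortP i s :
  [/\ perm_eq (outcome (timed_sort i s)) s,
      pairwise (by_bonus i) (outcome (timed_sort i s))
    & (cost (timed_sort i s) <= ((2 * size s).+2 * size s).+1)%N].
Proof.
have E r : pairwise (by_bonus i) r ->
  [/\ perm_eq (outcome (foreach s r (fun r c => insert i c r))) (s ++ r),
      pairwise (by_bonus i) (outcome (foreach s r (fun r c => insert i c r)))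
    & (cost (foreach s r (fun r c => insert i c r)) <=
       ((2 * (size s + size r)).+2 * size s).+1)%N].
  elim: s r => [|c s IH] r pair_r; first by split.
  rewrite foreach_cons /=.
  have [perm_c pair_c cost_c] := insertP i c r.
  have [perm_s pair_s cost_s] := IH _ (pair_c pair_r); split=> //.
    apply: perm_trans perm_s _; apply/permP => a.
    by rewrite /= !count_cat (permP perm_c) /=; lia.
  move: cost_s; rewrite (perm_size perm_c) /=; nia.
have [perm_s pair_s cost_s] := E [::] isT.
by split=> //; move: perm_s cost_s; rewrite cats0 addn0.
Qed.

(** The list is sorted by nonincreasing slack: if its first colour cannot be removed, none can, as
    [PruneStop] requires. *)
Lemma timed_pruneP (tslack : M -> timed int) (slack : M -> int) D Y :
    (forall d, outcome (tslack d) = slack d) -> (forall d, cost (tslack d) <= 2)%N ->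
    uniq D -> pairwise (fun d e => slack e <= slack d) D ->
  let: Timed (D', Y') n := timed_prune tslack D Y in
  [/\ prune slack [set d in D] Y [set d in D'] Y',
      subseq D' D, (size Y' <= size Y)%N,
      forall d, d \in D' -> slack d < (size Y')%:Z
    & (n <= (4 * size Y + 6) * (size D).+1)%N].
Proof.
move=> slackE cost_slack; elim: D Y => [|d D IH] Y /=.
  by move=> _ _; split=> //; [apply: PruneStop => d; rewrite !inE|lia].
case/andP => dD uniq_D /andP[all_d pair_D].
rewrite /timed_prune -/timed_prune /= slackE outcome_tsize.
have cs := cost_slack d; have cY := cost_tsize Y.
case: ifPn => [big|small] /=; last first.
  rewrite -ltNge in small.
  have stop e : e \in d :: D -> slack e < (size Y)%:Z.
    by rewrite inE => /predU1P[->//|/(allP all_d) /le_lt_trans]; apply.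
  split=> //; [|by rewrite eqxx; apply: subseq_refl|by nia].
  by apply: PruneStop => e; rewrite inE => /stop.
rewrite !outcome_tfilter /=.
have cF := @cost_tfilter _ (fun Z => op (d \notin Z)) Y 1 (fun _ => isT).
have := IH [seq Z : {set M} <- Y | d \notin Z] uniq_D pair_D.
case: (timed_prune _ _ _) => [[D' Y'] n] /= [pr sub szY stop le].
have szF : (size [seq Z : {set M} <- Y | d \notin Z] <= size Y)%N by rewrite size_filter count_size.
split=> //.
- apply: (@PruneStep _ _ _ _ d) => //; first by rewrite !inE eqxx.
  have -> : [set e in d :: D] :\ d = [set e in D] => //.
  by apply/setP => e; rewrite !inE; have [->|] := eqVneq e d; rewrite ?(negPf dD).
- exact: subseq_trans sub (subseq_cons _ _).
- exact: leq_trans szF.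
- by nia.
Qed.

Lemma card_colour_gt0 : (0 < #|M|)%N.
Proof.
have /card_gt0P[i _] := ltnW (node_gt1 G).
by have /set0Pn[c _] := avail_neq0 i; apply/card_gt0P; exists c.
Qed.

(** The numbers n1, ..., n9 are the costs of the stages of one test, with m colours and r
    predecessors. The matching stage n8 dominates: at most r searches of cost O(m (r + 1)). *)
Lemma test_cost_le (m r n1 n2 n3 n4 n5 n6 n7 n8 n9 s C d d' y0 y : nat) :
    (0 < m)%N -> (C <= m)%N -> (d <= m)%N -> (d' <= d)%N ->
    (s <= r)%N -> (y0 <= r)%N -> (y <= y0)%N ->
    (n1 <= (2 * r).+1)%N -> (n2 <= (2 * s).+1)%N -> (n3 <= (2 * C).+1)%N ->
    (n4 <= (4 * d).+1)%N -> (n5 <= ((2 * m).+2.+1 * r).+1)%N ->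
    (n6 <= (4 * y0 + 6) * d.+1)%N -> (n7 <= (4 * d').+1)%N ->
    (n8 <= 3 * y + m * y.+1 + 2 * d' +
      (m + (3 * d').+1 * (y + 1) + d' * (3 * y).+1).+2 * y + 3)%N ->
    (n9 <= (2 * y).+1)%N ->
  (n1 + (n2 + (n3 + (n4 + (n5 + (n6 + (n7 + (n8 + (n9 + 1)))))))) <=
    100 * (m * r.+1 ^ 2))%N.
Proof.
move=> m_gt0 Cm dm d'd sr y0r yy0 c1 c2 c3 c4 c5 c6 c7 c8 c9.
have mb : (m * r.+1 <= m * r.+1 ^ 2)%N by rewrite leq_mul2l leq_pmulr ?orbT.
have d'm := leq_trans d'd dm; have yr := leq_trans yy0 y0r.
have e5 : ((2 * m).+2.+1 * r <= 5 * (m * r.+1))%N by nia.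
have e6 : ((4 * y0 + 6) * d.+1 <= 12 * (m * r.+1))%N.
  by rewrite [leqRHS](_ : _ = ((6 * r.+1) * (2 * m))%N); [apply: leq_mul; lia|lia].
have e8 : ((m + (3 * d').+1 * (y + 1) + d' * (3 * y).+1).+2 * y <= 11 * (m * r.+1 ^ 2))%N.
  have f1 : ((3 * d').+1 * (y + 1) <= (4 * m) * r.+1)%N by apply: leq_mul; lia.
  have f2 : (d' * (3 * y).+1 <= m * (3 * r.+1))%N by apply: leq_mul; lia.
  rewrite [leqRHS](_ : _ = ((11 * (m * r.+1)) * r.+1)%N); last by rewrite expnS expn1; lia.
  by apply: leq_mul; [nia|lia].
have e8' : (m * y.+1 <= m * r.+1)%N by apply: leq_mul; lia.
have mm : (m <= m * r.+1)%N by rewrite leq_pmulr.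
have rr : (r.+1 <= m * r.+1)%N by rewrite leq_pmull.
by move: (m * r.+1 ^ 2)%N (m * r.+1)%N mb e5 e6 e8 e8' mm rr => a b; lia.
Qed.

Lemma timed_testP (verbatim : bool) i C Y c (r := timed_test verbatim i C Y c) :
    perm_eq C (enum (avail i)) -> pairwise (by_bonus i) C ->
  tested verbatim i Y c (outcome r) /\ (cost r <= 100 * (#|M| * (size Y).+1 ^ 2))%N.
Proof.
move=> perm_C pair_C; rewrite /r {r}.
have m_gt0 := card_colour_gt0.
have uniq_C : uniq C by rewrite (perm_uniq perm_C) enum_uniq.
have mem_C d : (d \in C) = (d \in avail i) by rewrite (perm_mem perm_C) mem_enum.
pose s := size [seq Z : {set M} <- Y | c \in Z].
pose slack d : int := s%:Z + bonus i c - bonus i d.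
pose D := [seq d <- C | d != c].
have mem_D : [set d in D] = avail i :\ c.
  by apply/setP => d; rewrite !inE mem_filter mem_C.
pose Y0 := [seq Z : {set M} <- Y | (c \notin Z) && constraining verbatim (avail i) Z].
have szC : (size C <= #|M|)%N.
  by rewrite (perm_size perm_C) -cardE max_card.
have szD : (size D <= #|M|)%N by rewrite (leq_trans _ szC) // size_filter count_size.
have szS : (s <= size Y)%N by rewrite /s size_filter count_size.
have szY0 : (size Y0 <= size Y)%N by rewrite /Y0 size_filter count_size.
(* Slacks are nonnegative here, so their absolute values are the right class sizes; after pruning
   they are less than |Y'|, as the cost bound needs. *)
have matching_sizeP D' Y' : (forall d, d \in D -> 0 <= slack d) ->
    (forall d, d \in D' -> d \in D) -> (forall d, d \in D' -> slack d < (size Y')%:Z) ->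
    uniq D' -> let: r := timed_matching_size [seq (d, `|slack d|%N) | d <- D'] Y' in
  (exists2 mu, maximum_matching (bip_adj slack [set d in D'] Y') mu
     & (outcome r == size Y') = (size mu == size Y')) /\
  (cost r <= 3 * size Y' + #|M| * (size Y').+1 + 2 * size D' +
    (#|M| + (3 * size D').+1 * (size Y' + 1) + size D' * (3 * size Y').+1).+2 * size Y' + 3)%N.
  move=> slack_ge0 subD' stop uniq_D'; set classes := [seq _ | d <- D'].
  have slack_abs d : d \in D' -> `|slack d|%N%:Z = slack d.
    by move=> /subD' /slack_ge0 /gez0_abs.
  have uniq_classes : uniq (unzip1 classes) by rewrite /unzip1 -map_comp map_id.
  have mem_slots p : (p \in slots classes) =
      [&& p.1 \in [set d in D'], (0 < p.2)%N & p.2%:Z <= slack p.1].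
    apply/slotP/and3P => [[t /mapP[d dD' [-> ->]]]|[]].
      by rewrite mem_iota inE dD' => /andP[-> lt]; split=> //; rewrite -slack_abs // lez_nat; lia.
    rewrite inE => pD' p_gt0 le; exists `|slack p.1|%N; first exact: map_f.
    by rewrite mem_iota p_gt0 /=; move: le; rewrite -slack_abs // lez_nat; lia.
  have [|] := timed_matching_sizeP (Y := Y') uniq_classes mem_slots.
    by move=> cl /mapP[d dD' ->] /=; rewrite -lez_nat slack_abs // ltW // stop.
  by rewrite /round_cost !size_map.
rewrite /timed_test /tested; move: (@timed_matching_size G) matching_sizeP => tms matching_sizeP.
rewrite /= !outcome_tfilter /= !outcome_tsize -/s -/D.
pose tslack d : timed int := let! v := op (s%:Z + bonus i c) in op (v - bonus i d).
have negE (s' : seq M) b :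
   foldl (fun b d => b || (slack d < 0)) b s' = b || has (fun d => slack d < 0) s'.
  by elim: s' b => [|d s' IH] b /=; rewrite ?orbF // IH orbA.
rewrite !outcome_foreach /= !negE /=.
have c1 := @cost_tfilter _ (fun Z : {set M} => op (c \in Z)) Y 1 (fun _ => isT).
have c2 := cost_tsize [seq Z : {set M} <- Y | c \in Z]; rewrite -/s in c2.
have c3 := @cost_tfilter _ (fun d => op (d != c)) C 1 (fun _ => isT).
have c4 : (cost (foreach D false (fun (b : bool) d =>
    let! v := tslack d in op (b || (v < 0)%R))) <= (4 * size D).+1)%N.
  exact: cost_foreach_const.
pose constrains Z := let! b := op (c \in Z) in
  if b then ret false else if verbatim then ret true else tsubset Z (avail i).
rewrite -![foreach D _ _]/(foreach D false (fun (b : bool) d =>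
    let! v := tslack d in op (b || (v < 0)%R))).
case: ifPn => [/hasP[d dD neg]|/hasPn nneg] /=.
  split; first by left; split=> //; exists d; rewrite -?mem_D ?inE.
  (* After an early rejection the remaining stages cost 0. *)
  exact: (@test_cost_le _ _ _ _ _ _ 0 0 0 0 0 s (size C) (size D) 0 0 0
    m_gt0 szC szD _ szS _ _ c1 c2 c3 c4).
have slack_ge0 d : d \in D -> 0 <= slack d by move=> /nneg; rewrite -leNgt.
have c5 : (cost (tfilter constrains Y) <= ((2 * #|M|).+2.+1 * size Y).+1)%N.
  apply: cost_tfilter => Z; rewrite /constrains /=; have := cost_tsubset Z (avail i).
  by case: (c \in Z); case: (verbatim) => /=; lia.
have Y0E : outcome (tfilter constrains Y) = Y0.
  rewrite outcome_tfilter; apply: eq_filter => Z; rewrite /constrains /constraining /=.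
  by case: (c \in Z); case: (verbatim); rewrite //= outcome_tsubset.
rewrite -/tslack -/constrains Y0E.
have pair_D : pairwise (fun d e => slack e <= slack d) D.
  apply: (sub_pairwise (r := by_bonus i)) => [d e de|].
    by rewrite /slack lerD2l lerN2.
  by rewrite pairwise_filter.
have := @timed_pruneP tslack slack D Y0 (fun _ => erefl) (fun _ => isT)
  (filter_uniq _ uniq_C) pair_D.
case: (timed_prune tslack D Y0) => [[D' Y'] cp] /= [pr sub szY' stop c6].
have subD' d : d \in D' -> d \in D by apply: mem_subseq.
have szD' : (size D' <= size D)%N by apply: size_subseq.
rewrite mem_D in pr; rewrite outcome_tmap /= outcome_tsize.
have c7 : (cost (tmap (fun d => let! v := tslack d in op (d, `|v|%N)) D') <= (4 * size D').+1)%N.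
  exact: cost_tmap.
have uniq_D' := subseq_uniq sub (filter_uniq _ uniq_C).
have [[mu max_mu outE] c8] := matching_sizeP _ _ slack_ge0 subD' stop uniq_D'.
split.
  right; split; first by move=> d; rewrite -mem_D inE; apply: slack_ge0.
  by exists [set d in D'], Y', mu; split=> //; apply: outE.
have c9 := cost_tsize Y'.
exact: (test_cost_le m_gt0 szC szD szD' szS szY0 szY' c1 c2 c3 c4 c5 c6 c7 c8 c9).
Qed.

End TimedTest.

(** * Whole runs and their total cost *)

Section TimedRuns.
Variables (verbatim : bool) (G : game) (q : query G).
Local Notation V := (node G).
Local Notation M := (colour G).
Implicit Types (i : V) (X : V -> {set M}).

Definition colour_node i X : timed {set M} :=
  let! C := timed_sort i (enum (avail i)) in
  let! Y := tmap (fun k => op (X k)) (preds i) in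
  let! none := fill #|M| set0 in
  foreach C none (fun Xi c =>
    let! b := timed_test verbatim i C Y c in
    if b then op (c |: Xi) else ret Xi).

(** The tests dominate: at most m of them, each of cost O(m (r + 1)^2) for r predecessors, against
    O(m^2) for the insertion sort. *)
Lemma colour_nodeP i X (r := colour_node i X) :
  coloured verbatim i X (outcome r) /\
  (cost r <= 120 * (#|M| ^ 2 * (size (preds i)).+1 ^ 2))%N.
Proof.
have m_gt0 := card_colour_gt0 G; rewrite /r {r}.
have [perm_C pair_C cost_C] := timed_sortP i (enum (avail i)).
have testP := fun C Y c => @timed_testP G verbatim i C Y c.
rewrite /colour_node; move: (@timed_test verbatim G) testP => test testP.
move: (timed_sort i) perm_C pair_C cost_C => tsort perm_C pair_C cost_C.
rewrite /= outcome_tmap /= !outcome_foreach /=.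
move: (tsort _) perm_C pair_C cost_C => [C n] /= perm_C pair_C cost_C.
have sz_avail : (size (enum (avail i)) <= #|M|)%N by rewrite -cardE max_card.
have szC : (size C <= #|M|)%N by rewrite (perm_size perm_C).
set Y := [seq X k | k <- preds i].
have szY : size Y = size (preds i) by rewrite size_map.
have foldE (f : M -> timed bool) (s : seq M) A c :
  (c \in foldl (fun Xi c => outcome (let! b := f c in if b then op (c |: Xi) else ret Xi)) A s) =
  (c \in A) || (c \in s) && outcome (f c).
  elim: s A => [|d s IH] A /=; first by rewrite orbF.
  rewrite IH inE; case E: (outcome (f d)) => /=; rewrite ?inE;
    have [->|] := eqVneq c d; rewrite ?E ?orbT ?andbF ?orbF //=.
split; first split.
- apply/subsetP => c; rewrite foldE inE /= => /andP[cC _].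
  by rewrite -mem_enum -(perm_mem perm_C).
- move=> c ci; rewrite foldE inE /= (perm_mem perm_C) mem_enum ci /=.
  by case: (testP C Y c perm_C pair_C).
have cY := @cost_tmap _ _ (fun k => op (X k)) (preds i) 1 (fun _ => isT).
have cF := @cost_foreach_const _ _ C set0 (fun Xi c =>
    let! b := test i C Y c in if b then op (c |: Xi) else ret Xi)
  (100 * (#|M| * (size Y).+1 ^ 2)).+1.
have body_le A c : (cost (let! b := test i C Y c in if b then op (c |: A) else ret A) <=
    (100 * (#|M| * (size Y).+1 ^ 2)).+1)%N.
  have [_ /=] := testP C Y c perm_C pair_C; case: (test i C Y c) => b n' /=.
  by move: (100 * _)%N => k; case: b => /=; lia.
apply: leq_trans (leq_add (leqnn _) (leq_add cY (leq_add (leqnn _) (cF body_le)))) _.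
rewrite szY; move: (size (preds i)) #|M| m_gt0 (size C) szC (size (enum _)) sz_avail cost_C.
clear=> r m m_gt0 C szC a sz_a cost_n.
have e1 : (((2 * a).+2 * a) <= (4 * m) * m)%N by apply: leq_mul; lia.
have e2 : ((100 * (m * r.+1 ^ 2)).+2 * C <= (100 * (m * r.+1 ^ 2)).+2 * m)%N.
  by rewrite leq_mul2l szC orbT.
have e3 : (m * m <= m ^ 2 * r.+1 ^ 2)%N by rewrite mulnn leq_pmulr // expn_gt0.
have e4 : (r.+1 <= m ^ 2 * r.+1 ^ 2)%N.
  apply: (@leq_trans (1 * r.+1 ^ 2)); first by rewrite mul1n leq_pmulr.
  by rewrite leq_mul2r expn_gt0 m_gt0 orbT.
have e5 : (m <= m * m)%N by rewrite leq_pmulr.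
have e6 : ((100 * (m * r.+1 ^ 2)).+2 * m = 100 * (m ^ 2 * r.+1 ^ 2) + 2 * m)%N.
  by rewrite -addn2 mulnDl; congr addn; rewrite -mulnA; congr muln; rewrite mulnAC mulnn.
rewrite e6 in e2; move: (m ^ 2 * r.+1 ^ 2)%N e2 e3 e4 => b e2 e3 e4.
by move: e1; rewrite -mulnA; move: (m * m)%N e3 e5 => mm e3 e5; lia.
Qed.

Lemma bindA A B C (m : timed A) (f : A -> timed B) (g : B -> timed C) :
  bind (bind m f) g = bind m (fun a => bind (f a) g).
Proof. by rewrite /bind /= addnA. Qed.

Lemma eq_bind A B (m : timed A) (f g : A -> timed B) :
  f (outcome m) = g (outcome m) -> bind m f = bind m g.
Proof. by rewrite /bind => ->. Qed.

Lemma timed_run_cons i order X :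
  timed_run verbatim q (i :: order) X =
  let! Xi := colour_node i X in
  let! a := op (i \in asked q) in
  if a then
    let! b := op (wanted q i \in Xi) in
    if b then
      let! Xq := fill #|M| [set wanted q i] in
      let! X' := op (upd X i Xq) in
      timed_run verbatim q order X'
    else op false
  else
    let! X' := op (upd X i Xi) in
    timed_run verbatim q order X'.
Proof. by rewrite /colour_node bindA; do 2![apply: eq_bind; rewrite bindA]. Qed.

(** The constant is 120 for colouring the node and 4 for the rest: creating the singleton table
    costs |M|, and at most three single operations are added. *)
Lemma timed_runP order X (r := timed_run verbatim q order X) :
  run verbatim q order X (outcome r) /\
  (cost r <= (\sum_(i <- order) 124 * (#|M| ^ 2 * (size (preds i)).+1 ^ 2)).+1)%N.
Proof.
have m_gt0 := card_colour_gt0 G; rewrite /r {r}.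
elim: order X => [|i order IH] X; first by rewrite big_nil; split; first exact: RunEnd.
have [] := colour_nodeP i X; rewrite timed_run_cons big_cons.
case: (colour_node i X) => Xi n.
set b := (#|M| ^ 2 * (size (preds i)).+1 ^ 2)%N; set sum := (\sum_(_ <- _) _)%N in IH *.
move=> /= col cost_n.
have m_le : (#|M| <= b)%N.
  apply: (@leq_trans (#|M| ^ 2)); first by rewrite -mulnn leq_pmulr.
  by rewrite leq_pmulr // expn_gt0.
have b_gt0 : (0 < b)%N by apply: leq_trans m_le.
case: ifPn => ia /=; last first.
  have [rn le] := IH (upd X i Xi); split; first exact: (RunFree col ia rn).
  by move: le; clearbody sum b; lia.
case: ifPn => /= w; last by split; [exact: (RunReject _ col ia w)|clearbody sum b; lia].
have [rn le] := IH (upd X i [set wanted q i]); split; first exact: (RunAsked col ia w rn).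
by clearbody sum b; move: (cost _) #|M| le m_le => c m le m_le; lia.
Qed.

Lemma timed_EP : acyclic G -> algorithm_E verbatim q (outcome (timed_E verbatim q)).
Proof.
move=> acyc; exists (outcome (timed_topsort G)).
  exact/topological_of_from/topsort_topo.
by have [] := timed_runP (outcome (timed_topsort G)) (fun=> set0).
Qed.

Lemma cost_timed_E : acyclic G -> out_degree_le1 G ->
  (cost (timed_E verbatim q) <= 600 * game_size G ^ 2)%N.
Proof.
move=> acyc deg1.
have [perm_order _] := topological_of_from (topsort_topo acyc).
have [_] := timed_runP (outcome (timed_topsort G)) (fun=> set0).
rewrite (perm_big _ perm_order) big_enum_nat /= -!big_distrr /= => cost_run.
have cost_topo := cost_topsort deg1.
apply: leq_trans (leq_add cost_topo (leq_add (leqnn _) cost_run)) _.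
(* A sum of squares is at most the square of the sum, and the in-degrees, each increased by one, add
   up to at most 2|V|. *)
have squares : (\sum_(i : V) (size (preds i)).+1 ^ 2 <= (2 * #|V|) ^ 2)%N.
  apply: (@leq_trans ((\sum_(i : V) (size (preds i)).+1) ^ 2)).
    rewrite expnS expn1 big_distrl /= leq_sum // => i _.
    by rewrite expnS expn1 leq_mul2l (bigD1 i) //= leq_addr.
  rewrite leq_exp2r //; under eq_bigr do rewrite -addn1.
  rewrite big_split /= sum1_card mul2n -addnn leq_add2r.
  exact: sum_size_preds.
have m_gt0 := card_colour_gt0 G; have n_gt1 := node_gt1 G.
have size_ge : (#|V| * #|M| <= game_size G)%N by rewrite leq_addr.
have : (600 * (#|V| * #|M|) ^ 2 <= 600 * game_size G ^ 2)%N.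
  by rewrite leq_mul2l leq_exp2r.
apply: leq_trans.
have e1 : (#|M| ^ 2 * \sum_(i : V) (size (preds i)).+1 ^ 2 <= 4 * (#|V| * #|M|) ^ 2)%N.
  apply: leq_trans (leq_mul (leqnn _) squares) _.
  by rewrite !expnMn mulnCA mulnA [X in (X <= _)%N]mulnAC -mulnA.
have e2 : (#|V| <= #|V| * #|M|)%N by rewrite leq_pmulr.
have e3 : (#|V| * #|M| <= (#|V| * #|M|) ^ 2)%N.
  by rewrite -mulnn leq_pmulr // muln_gt0 m_gt0 ltnW.
(* With b = |V| |M|, the run costs at most 124 * 4 * b^2 + 1, the topological sort 20 b and the
   table b: in all at most 518 b^2. *)
move: (_ * \sum_(_ | _) _)%N e1 => a; move: (#|V| * #|M|)%N e2 e3 => b.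
by move: (b ^ 2)%N #|V| n_gt1 => c n; lia.
Qed.
End TimedRuns.

Theorem theorem8 (R : realType) :
  exists K : R, forall (verbatim : bool) (G : game) (q : query G),
    acyclic G -> out_degree_le1 G ->
    [/\ (verbatim -> forall k i : node G, edge k i -> avail k \subset avail i) ->
          forall answer : bool, algorithm_E verbatim q answer ->
            (answer <-> exists s, nash s /\ consistent s q),
        algorithm_E verbatim q (outcome (timed_E verbatim q))
      & (cost (timed_E verbatim q))%:R <= K * (game_size G)%:R `^ (5%:R / 2%:R)].
Proof.
exists 600%:R => verbatim G q acyc deg1; split.
- by move=> sub answer; apply: algorithm_E_correct.
- exact: timed_EP.
(* The quadratic bound implies the claim: the game size is at least 1, so powers increase from
   exponent 2 to 5/2. *)
apply: (@le_trans _ _ (600%:R * (game_size G)%:R ^+ 2)).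
  by rewrite -natrX -natrM ler_nat cost_timed_E.
rewrite ler_wpM2l ?ler0n // -powR_mulrn ?ler0n //.
have size_ge1 : (1 <= game_size G)%N.
  rewrite /game_size addn_gt0 muln_gt0 card_colour_gt0 andbT.
  by rewrite (ltnW (node_gt1 G)).
rewrite ler_powR ?ler1n //.
by rewrite ler_pdivlMr ?ltr0n // -natrM ler_nat.
Qed.
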